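(* Let $\mathcal{H}$ be a finite-dimensional complex Hilbert space. There exists a quantum universal variable-length source code $\{(\mathbf{E}^{n},\mathbf{D}^{n})\}_{n\ge 1}$, where $(\mathbf{E}^n,\mathbf{D}^n)$ is a variable-length code on $\mathcal{H}^{\otimes n}$ with data set $\Omega_n$ and compressed spaces $\mathcal{H}_{\omega_n}$ ($\omega_n\in\Omega_n$), such that for every probability distribution $p$ on density operators on $\mathcal{H}$ and every $\epsilon>0$, $$\lim_{n\to\infty}\mathrm{P}_{n,p}^{\mathbf{E}^n}\left\{\frac{1}{n}\left(\log|\Omega_n|+\log\dim\mathcal{H}_{\omega_n}\right)\ge H(\overline{\rho}_p)+\epsilon\right\}=0,$$ where $\overline{\rho}_p=\sum_\rho p(\rho)\rho$ and $H(\rho)=-\mathrm{Tr}\,\rho\log\rho$.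
   Context: Logarithms are natural. $\mathcal{S}(\mathcal{K})$ is the set of density operators on $\mathcal{K}$. TP-CP means trace-preserving completely positive. Bures' distance: $b(\rho,\sigma):=\sqrt{1-\mathrm{Tr}\,|\sqrt{\rho}\sqrt{\sigma}|}$. Variable-length code on a finite-dimensional Hilbert space $\mathcal{K}$: a finite data set $\Omega$; a POVM $\{M_\omega\}_{\omega\in\Omega}$ on $\mathcal{K}$; finite-dimensional Hilbert spaces $\mathcal{H}_\omega$; TP-CP maps $E_\omega$ from operators on $\mathcal{K}$ to operators on $\mathcal{H}_\omega$; the encoder is $\mathbf{E}=\{\mathbf{E}_\omega\}_{\omega\in\Omega}$ with $\mathbf{E}_\omega(\rho):=E_\omega(\sqrt{M_\omega}\,\rho\,\sqrt{M_\omega})$; the decoder is a family $\mathbf{D}=\{\mathbf{D}_\omega\}_{\omega\in\Omega}$ of TP-CP maps from operators on $\mathcal{H}_\omega$ to operators on $\mathcal{K}$. The coding length for outcome $\omega$ is $\log|\Omega|+\log\dim\mathcal{H}_\omega$. Source: $p$ is a (discrete) probability distribution on $\mathcal{S}(\mathcal{H})$; the source emits $\vec{\rho}_n=\rho_1\otimes\cdots\otimes\rho_n$ with the i.i.d. probability $p^n(\vec\rho_n)=p(\rho_1)\cdots p(\rho_n)$. For a code $(\mathbf{E}^n,\mathbf{D}^n)$ on $\mathcal{H}^{\otimes n}$, the distribution of the outcome is $$\mathrm{P}_{n,p}^{\mathbf{E}^n}(\omega_n):=\sum_{\vec\rho_n}p^n(\vec\rho_n)\,\mathrm{Tr}\,\mathbf{E}^n_{\omega_n}(\vec\rho_n)=\mathrm{Tr}\,\mathbf{E}^n_{\omega_n}(\overline{\rho}_p^{\otimes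 n}),$$ and the average error is $$\epsilon_{n,p}(\mathbf{E}^n,\mathbf{D}^n):=\sum_{\vec\rho_n}p^n(\vec\rho_n)\sum_{\omega_n\in\Omega_n}\mathrm{Tr}\,\mathbf{E}^n_{\omega_n}(\vec\rho_n)\;b^2\!\left(\vec\rho_n,\mathbf{D}^n_{\omega_n}\!\left(\frac{\mathbf{E}^n_{\omega_n}(\vec\rho_n)}{\mathrm{Tr}\,\mathbf{E}^n_{\omega_n}(\vec\rho_n)}\right)\right),$$ terms with $\mathrm{Tr}\,\mathbf{E}^n_{\omega_n}(\vec\rho_n)=0$ being $0$. The sequence $\{(\mathbf{E}^n,\mathbf{D}^n)\}$ (which does not depend on $p$) is called universal if $\epsilon_{n,p}(\mathbf{E}^n,\mathbf{D}^n)\to0$ as $n\to\infty$ for every $p$. *)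

(* Defs.v *)
From HB Require Import structures.
From mathcomp Require Import all_boot all_order all_algebra.
From mathcomp Require Import spectral.
From mathcomp Require Import all_classical all_reals all_analysis.
From mathcomp Require Import complex mxtens.

Set Implicit Arguments.
Unset Strict Implicit.
Unset Printing Implicit Defensive.

Import Order.TTheory GRing.Theory Num.Theory.
Import numFieldNormedType.Exports.

Local Open Scope classical_set_scope.
Local Open Scope ring_scope.
Local Open Scope complex_scope.
Local Open Scope sesquilinear_scope.

(* A k-dimensional complex Hilbert space is C^k with
   C = R[i] for R : realType, and operators on it are k x k matrices acting on
   column vectors. *)

Section Operators.
Variable R : realType.

(* The order of R[i] makes 0 <= z mean that z is real and nonnegative, so that
   positivity entails hermitianity. *)
Definition psd (k : nat) (A : 'M[R[i]]_k) : Prop :=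
  forall x : 'cV[R[i]]_k, 0 <= (x ^t* *m A *m x) 0 0.

Definition density (k : nat) : set 'M[R[i]]_k :=
  [set rho | psd rho /\ \tr rho = 1].

(* Functional calculus f(A) for a normal matrix A: the spectral theorem
   [orthomx_spectralP] reads
   A = invmx (spectralmx A) *m diag_mx (spectral_diag A) *m spectralmx A. *)
Definition mxfun (f : R[i] -> R[i]) (k : nat) (A : 'M[R[i]]_k) : 'M[R[i]]_k :=
  invmx (spectralmx A) *m diag_mx (map_mx f (spectral_diag A)) *m spectralmx A.

Definition mxsqrt (k : nat) (A : 'M[R[i]]_k) : 'M[R[i]]_k := mxfun sqrtC A.

Definition mxabs (k : nat) (A : 'M[R[i]]_k) : 'M[R[i]]_k :=
  mxsqrt (A ^t* *m A).

(* As ln 0 = 0 in the library, rho *m mxln rho follows the convention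
   0 log 0 = 0. *)
Definition mxln (k : nat) (A : 'M[R[i]]_k) : 'M[R[i]]_k :=
  mxfun (fun z : R[i] => (ln (complex.Re z))%:C) A.

Definition Rtr (k : nat) (A : 'M[R[i]]_k) : R := complex.Re (\tr A).

Definition entropy (k : nat) (rho : 'M[R[i]]_k) : R :=
  - Rtr (rho *m mxln rho).

Definition bures (k : nat) (rho sigma : 'M[R[i]]_k) : R :=
  Num.sqrt (1 - Rtr (mxabs (mxsqrt rho *m mxsqrt sigma))).

(* The map id_r (x) Phi on operators on C^r (x) C^m; the index set 'I_(r * m)
   is identified with 'I_r * 'I_m as for the Kronecker product [tensmx]. *)
Definition ampliation (r m k : nat) (Phi : 'M[R[i]]_m -> 'M[R[i]]_k)
    (X : 'M[R[i]]_(r * m)) : 'M[R[i]]_(r * k) :=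
  \matrix_(i, j)
    Phi (\matrix_(a, b)
           X (mxtens_index ((mxtens_unindex i).1, a))
             (mxtens_index ((mxtens_unindex j).1, b)))
        (mxtens_unindex i).2 (mxtens_unindex j).2.

Definition completely_positive (m k : nat)
    (Phi : {linear 'M[R[i]]_m -> 'M[R[i]]_k}) : Prop :=
  forall (r : nat) (X : 'M[R[i]]_(r * m)), psd X -> psd (ampliation Phi X).

Definition trace_preserving (m k : nat)
    (Phi : {linear 'M[R[i]]_m -> 'M[R[i]]_k}) : Prop :=
  forall X : 'M[R[i]]_m, \tr (Phi X) = \tr X.

Definition tpcp (m k : nat) (Phi : {linear 'M[R[i]]_m -> 'M[R[i]]_k}) : Prop :=
  trace_preserving Phi /\ completely_positive Phi.

(* The canonical basis of (C^d)^{(x) n} is indexed by {ffun 'I_n -> 'I_d}, so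
   its dimension is d ^ n ([card_ffun]), and the entries of
   rho_1 (x) ... (x) rho_n are products of entries. *)
Definition pow_dim (d n : nat) : nat := #|{ffun 'I_n -> 'I_d}|.

Definition basis_index (d n : nat) (a : 'I_(pow_dim d n)) :
    {ffun 'I_n -> 'I_d} :=
  enum_val a.

Definition tensor (d n : nat) (rho : 'I_n -> 'M[R[i]]_d) :
    'M[R[i]]_(pow_dim d n) :=
  \matrix_(a, b) \prod_(t < n) rho t (basis_index a t) (basis_index b t).

End Operators.

(* A variable-length code on C^k; [cdim w] is the dimension of the space
   H_w. *)
Record vlcode (R : realType) (k : nat) := VLCode {
  data : finType;
  povm : data -> 'M[R[i]]_k;
  povm_psd : forall w, psd (povm w);
  povm_sum : \sum_(w : data) povm w = 1%:M;
  cdim : data -> nat;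
  enc_chan : forall w : data, {linear 'M[R[i]]_k -> 'M[R[i]]_(cdim w)};
  enc_tpcp : forall w, tpcp (enc_chan w);
  dec_chan : forall w : data, {linear 'M[R[i]]_(cdim w) -> 'M[R[i]]_k};
  dec_tpcp : forall w, tpcp (dec_chan w) }.

Definition encode (R : realType) (k : nat) (c : vlcode R k) (w : data c)
    (rho : 'M[R[i]]_k) : 'M[R[i]]_(cdim w) :=
  enc_chan w (mxsqrt (povm w) *m rho *m mxsqrt (povm w)).

Definition coding_length (R : realType) (k : nat) (c : vlcode R k)
    (w : data c) : R :=
  ln (#|data c|%:R) + ln ((cdim w)%:R).

(* A discrete probability distribution on the density operators, given by its
   mass function; the support is countable, as it has total mass 1. *)
Record source (R : realType) (d : nat) := Source {
  mass :> 'M[R[i]]_d -> R;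
  mass_ge0 : forall rho, 0 <= mass rho;
  mass_out : forall rho, ~ density rho -> mass rho = 0;
  mass_sum : \esum_(rho in @density R d) (mass rho)%:E = 1%E }.

Section Source.
Variables (R : realType) (d : nat).

(* The sum of an absolutely summable real family. *)
Definition rsum (T : choiceType) (S : set T) (f : T -> R) : R :=
  fine (\esum_(x in S) (Num.max (f x) 0)%:E)
  - fine (\esum_(x in S) (Num.max (- f x) 0)%:E).

(* The entries of density operators have modulus at most 1, so the sum of
   p(rho) rho converges absolutely, entry by entry. *)
Definition average (p : source R d) : 'M[R[i]]_d :=
  \matrix_(i, j)
    (rsum (@density R d) (fun rho => p rho * complex.Re (rho i j))
     +i* rsum (@density R d) (fun rho => p rho * complex.Im (rho i j))).

Definition states (n : nat) : set {ffun 'I_n -> 'M[R[i]]_d} :=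
  [set rho | forall t, density (rho t)].

Definition iid (p : source R d) (n : nat) (rho : {ffun 'I_n -> 'M[R[i]]_d}) :
    R :=
  \prod_(t < n) p (rho t).

Definition outcome_prob (p : source R d) (n : nat)
    (c : vlcode R (pow_dim d n)) (w : data c) : \bar R :=
  \esum_(rho in @states n) (iid p rho * Rtr (encode w (tensor rho)))%:E.

Definition event_prob (p : source R d) (n : nat)
    (c : vlcode R (pow_dim d n)) (A : {set data c}) : \bar R :=
  (\sum_(w in A) outcome_prob p w)%E.

(* When the trace of the encoded operator is 0, the summand is 0. *)
Definition avg_error (p : source R d) (n : nat)
    (c : vlcode R (pow_dim d n)) : \bar R :=
  \esum_(rho in @states n)
    (iid p rho *
     \sum_(w : data c)
       let s := encode w (tensor rho) in
       Rtr s * bures (tensor rho) (dec_chan w ((\tr s)^-1 *: s)) ^+ 2)%:E.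

Definition universal (c : forall n : nat, vlcode R (pow_dim d n)) : Prop :=
  forall p : source R d, avg_error p (c n) @[n --> \oo] --> 0%E.

End Source.

(* Main.v *)
(* For a sequence I of basis indices let t(I) be the size of its type class. For
   each r let V_r be a subspace containing U^{(x) n} e_I for every matrix U and
   every I with t(I) <= e^{nr}; since all U^{(x) n} lie in a space of polynomial
   dimension, V_r can be chosen of dimension poly(n) e^{nr}. A sequence of
   eigenvalue product >= e^{-nr} satisfies t(I) <= e^{nr}, so by Chebyshev's
   inequality the state rho^{(x) n} lies almost entirely in V_r for r > H(rho),
   and by a dimension count it has almost no mass there for r < H(rho).
   The V_r are nested, so their projectors form a spectral measure of the rate.
   The encoder measures the rate in cells of width 1/M, on a grid shifted by a
   uniformly random multiple s / M^2 (s < M) which is part of the data, and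
   compresses to V_r for r the upper end of the cell. H(rho) is at distance
   O(1/M^2) from the shifted grid for O(1) of the M shifts only; for the others
   the outcome is almost certain, so that the measurement is gentle. With
   M ~ log n both the error and the excess rate are O(1/M). *)

Require Import Defs.
From HB Require Import structures.
From mathcomp Require Import all_boot all_order all_algebra.
From mathcomp Require Import spectral.
From mathcomp Require Import all_classical all_reals all_analysis.
From mathcomp Require Import complex mxtens.
From mathcomp Require Import ring lra zify.

Set Implicit Arguments.
Unset Strict Implicit.
Unset Printing Implicit Defensive.

Import Order.TTheory GRing.Theory Num.Theory.
Import numFieldNormedType.Exports.

Local Open Scope classical_set_scope.
Local Open Scope ring_scope.

(** * Positive matrices and functional calculus *)

(* psd, mxfun, mxsqrt, ampliation and tensor are redefined over an abstract
   field C, to which they are convertible at C = R[i]: the arithmetic of R[i]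
   itself reduces, which makes matrix identities over it unmanageable. *)
Section LinearAlgebra.
Local Open Scope sesquilinear_scope.
Variable C : numClosedFieldType.

(** Typicality is known for the average state only, while the error averages over single sequences
    of states, which need not commute with it or with each other. Linearity closes the gap: for each
    sequence the error is at most twice its trace against one fixed positive operator, [miss_op],
    and source averages of such traces are bounded by the value at the tensor power of the average
    state. The random shift answers an obstacle of any fixed grid: if H(rho) lies at a cell
    boundary, the mass can split between two cells and the measurement may then disturb the state by
    a constant amount. Averaging over shifts dilutes this to O(1/M) for every source at once, and
    recording the shift costs only log M. The exponents balance as follows. Chebyshev's inequality
    at resolution 1/M^2 fails with probability at most V M^4 / n, which is O(1/M) when M^5 = O(n).
    The polynomial factors of the dimensions, of size e^{O(M)}, are absorbed by e^{-2n/M^2}, since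
    n/M^2 is at least of order M^3. A logarithmic M satisfies all this with room to spare. *)

Lemma adjmxM m n p (A : 'M[C]_(m, n)) (B : 'M[C]_(n, p)) :
  (A *m B)^t* = B^t* *m A^t*.
Proof. by rewrite trmx_mul map_mxM. Qed.

Lemma adjmxD m n (A B : 'M[C]_(m, n)) : (A + B)^t* = A^t* + B^t*.
Proof. by rewrite linearD map_mxD. Qed.

Lemma adjmxB m n (A B : 'M[C]_(m, n)) : (A - B)^t* = A^t* - B^t*.
Proof. by rewrite linearB map_mxB. Qed.

Lemma adjmxZ m n (c : C) (A : 'M[C]_(m, n)) : (c *: A)^t* = c^* *: A^t*.
Proof. by apply/matrixP => i j; rewrite !mxE rmorphM. Qed.

Lemma adjmx1 n : (1%:M : 'M[C]_n)^t* = 1%:M.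
Proof. by rewrite trmx1 map_mx1. Qed.

Lemma gram_ge0 m (x : 'cV[C]_m) : 0 <= (x^t* *m x) 0 0.
Proof.
by rewrite mxE sumr_ge0 // => i _; rewrite !mxE mulrC mul_conjC_ge0.
Qed.

Lemma quad_delta n (A : 'M[C]_n) (i j : 'I_n) :
  ((delta_mx i 0 : 'cV[C]_n)^t* *m A *m (delta_mx j 0 : 'cV[C]_n)) 0 0 = A i j.
Proof.
rewrite (_ : (delta_mx i 0)^t* = delta_mx 0 i); last first.
  apply/matrixP => a b; rewrite !mxE andbC.
  by case: (_ && _); rewrite ?rmorph1 ?rmorph0.
by rewrite -rowE -colE !mxE.
Qed.

(** Polarisation over the complex field: coefficient 1 gives B i j + B j i = 0 and coefficient i
    gives B i j - B j i = 0. This is what makes a [posmx] matrix hermitian. *)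
Lemma quad_eq0 n (B : 'M[C]_n) :
  (forall x : 'cV[C]_n, (x^t* *m B *m x) 0 0 = 0) -> B = 0.
Proof.
move=> hB; have hd i : B i i = 0 by rewrite -[LHS]quad_delta hB.
have hs (c : C) i j : c * B i j + c^* * B j i = 0.
  have := hB (delta_mx i 0 + c *: delta_mx j 0).
  have eD (M N : 'M[C]_1) : (M + N) 0 0 = M 0 0 + N 0 0 by rewrite mxE.
  have eZ a (M : 'M[C]_1) : (a *: M) 0 0 = a * M 0 0 by rewrite mxE.
  rewrite adjmxD adjmxZ !mulmxDl !mulmxDr -!scalemxAl -!scalemxAr.
  by rewrite !eD !eZ !quad_delta !hd !mulr0 add0r addr0.
apply/matrixP => i j; rewrite !mxE.
have h1 := hs 1 i j; have h2 := hs 'i i j.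
rewrite conjC1 !mul1r in h1; rewrite conjCi mulNr -mulrBr in h2.
move/eqP : h2; rewrite mulf_eq0 (negbTE (neq0Ci _)) /= subr_eq0 => /eqP h2.
move: h1; rewrite -h2 => /eqP; rewrite -mulr2n mulrn_eq0 /= => /eqP //.
Qed.

Lemma herm_normal n (A : 'M[C]_n) : A^t* = A -> A \is normalmx.
Proof. by move=> hA; apply/normalmxP; rewrite hA. Qed.

(* In the eigenbases the (i, j) entry of X is 0 unless the eigenvalues agree. *)
Lemma intertwine_fun (f : C -> C) m n (U : 'M[C]_m) (V : 'M[C]_n)
    (D : 'rV[C]_m) (E : 'rV[C]_n) (X : 'M[C]_(n, m)) :
  U \in unitmx -> V \in unitmx ->
  X *m (invmx U *m diag_mx D *m U) = (invmx V *m diag_mx E *m V) *m X ->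
  X *m (invmx U *m diag_mx (map_mx f D) *m U)
  = (invmx V *m diag_mx (map_mx f E) *m V) *m X.
Proof.
move=> hU hV h.
have [W hX] : exists W : 'M[C]_(n, m), X = invmx V *m W *m U.
  by exists (V *m X *m invmx U); rewrite !mulmxA mulVmx // mul1mx mulmxKV.
have hW : W *m diag_mx D = diag_mx E *m W.
  have := congr1 (fun Y => V *m Y *m invmx U) h; rewrite /= hX.
  by rewrite !mulmxA mulmxV // !mul1mx !mulmxK.
suff hW' : W *m diag_mx (map_mx f D) = diag_mx (map_mx f E) *m W.
  rewrite hX -!mulmxA (mulmxA U) mulmxV // mul1mx (mulmxA W) hW'.
  by rewrite (mulmxA V) mulmxV // mul1mx !mulmxA.
apply/matrixP => i j; rewrite mul_mx_diag mul_diag_mx !mxE.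
have /matrixP/(_ i j) := hW; rewrite mul_mx_diag mul_diag_mx !mxE => e.
have [->|ne] := eqVneq (D 0 j) (E 0 i); first by rewrite mulrC.
suff -> : W i j = 0 by rewrite mulr0 mul0r.
apply/eqP; have /eqP : W i j * (D 0 j - E 0 i) = 0.
  by rewrite mulrBr e mulrC subrr.
by rewrite mulf_eq0 subr_eq0 (negbTE ne) orbF.
Qed.

Definition posmx n (A : 'M[C]_n) : Prop :=
  forall x : 'cV[C]_n, 0 <= (x^t* *m A *m x) 0 0.

Definition funmx (f : C -> C) n (A : 'M[C]_n) : 'M[C]_n :=
  invmx (spectralmx A) *m diag_mx (map_mx f (spectral_diag A)) *m spectralmx A.

Definition sqrtmx n (A : 'M[C]_n) : 'M[C]_n := funmx sqrtC A.

Lemma posmx_gram m n (B : 'M[C]_(m, n)) : posmx (B^t* *m B).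
Proof.
move=> x; rewrite mulmxA -mulmxA -adjmxM; exact: gram_ge0.
Qed.

Lemma posmx_conj m n (A : 'M[C]_m) (B : 'M[C]_(m, n)) :
  posmx A -> posmx (B^t* *m A *m B).
Proof.
by move=> hA x; have := hA (B *m x); rewrite adjmxM !mulmxA.
Qed.

Lemma posmxD n (A B : 'M[C]_n) : posmx A -> posmx B -> posmx (A + B).
Proof.
move=> hA hB x; rewrite mulmxDr mulmxDl [in X in _ <= X]mxE.
by apply: addr_ge0.
Qed.

Lemma posmxZ n (c : C) (A : 'M[C]_n) : 0 <= c -> posmx A -> posmx (c *: A).
Proof.
move=> c0 hA x; rewrite -scalemxAr -scalemxAl [in X in _ <= X]mxE.
by apply: mulr_ge0.
Qed.

Lemma posmx0 n : posmx (0 : 'M[C]_n).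
Proof. by move=> x; rewrite mulmx0 mul0mx mxE. Qed.

Lemma posmx1 n : posmx (1%:M : 'M[C]_n).
Proof. by move=> x; rewrite mulmx1; exact: gram_ge0. Qed.

Lemma posmx_sum n (I : Type) (r : seq I) (P : pred I) (F : I -> 'M[C]_n) :
  (forall i, P i -> posmx (F i)) -> posmx (\sum_(i <- r | P i) F i).
Proof.
move=> hF; apply: (big_ind (@posmx n)); [exact: posmx0|move=> A B; exact: posmxD|exact: hF].
Qed.

Lemma posmx_herm n (A : 'M[C]_n) : posmx A -> A^t* = A.
Proof.
move=> hA; apply/eqP; rewrite -subr_eq0; apply/eqP/quad_eq0 => x.
rewrite mulmxBr mulmxBl [LHS]mxE [X in _ + X]mxE.
suff -> : x^t* *m A^t* *m x = (x^t* *m A *m x)^t*.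
  by rewrite [X in X - _]mxE mxE (conj_Creal (ger0_real (hA x))) subrr.
by rewrite !adjmxM trmxCK mulmxA.
Qed.

Lemma posmx_trace_ge0 n (A : 'M[C]_n) : posmx A -> 0 <= \tr A.
Proof.
by move=> hA; apply: sumr_ge0 => i _; rewrite -quad_delta; apply: hA.
Qed.

(** Intertwining by the identity matrix shows that the eigenbasis chosen by [spectralmx] does not
    matter: any diagonalisation, even a non-unitary one, computes [funmx]. *)
Lemma funmxE (f : C -> C) n (U A : 'M[C]_n) (D : 'rV[C]_n) :
  A \is normalmx -> U \in unitmx -> A = invmx U *m diag_mx D *m U ->
  funmx f A = invmx U *m diag_mx (map_mx f D) *m U.
Proof.
move=> nA hU hA; rewrite /funmx.
have := @intertwine_fun f n n (spectralmx A) U (spectral_diag A) D 1%:M.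
rewrite !mul1mx !mulmx1 -hA => h.
by apply: h; [exact: spectral_unit|exact: hU|exact/esym/orthomx_spectralP].
Qed.

Lemma unitary_conj_posmx n (U : 'M[C]_n) (D : 'rV[C]_n) :
  U \is unitarymx -> (forall i, 0 <= D 0 i) ->
  posmx (invmx U *m diag_mx D *m U).
Proof.
move=> hU hD; rewrite (invmx_unitary hU); apply: posmx_conj => x.
rewrite -mulmxA mul_diag_mx mxE sumr_ge0 // => i _; rewrite !mxE.
by rewrite mulrCA mulr_ge0 // mulrC mul_conjC_ge0.
Qed.

Lemma spectral_posmx n (A : 'M[C]_n) : posmx A ->
  A = invmx (spectralmx A) *m diag_mx (spectral_diag A) *m spectralmx A
  /\ forall i, 0 <= spectral_diag A 0 i.
Proof.
move=> hA; have hE : A = invmx (spectralmx A) *m diag_mx (spectral_diag A)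
    *m spectralmx A.
  by apply/orthomx_spectralP/herm_normal/posmx_herm.
split=> // i; have hU := spectral_unitarymx A.
have -> : spectral_diag A 0 i = (spectralmx A *m A *m (spectralmx A)^t*) i i.
  rewrite {3}hE -(invmx_unitary hU) -!mulmxA mulmxV ?spectral_unit //.
  by rewrite mulmx1 mulmxA mulmxV ?spectral_unit // mul1mx mxE eqxx.
rewrite -[X in _ <= X]quad_delta -{1}(trmxCK (spectralmx A)).
exact: (posmx_conj ((spectralmx A)^t*) hA).
Qed.

Lemma trace_mul_funmx (f : C -> C) n (A : 'M[C]_n) : posmx A ->
  \tr (A *m funmx f A) = \sum_i spectral_diag A 0 i * f (spectral_diag A 0 i).
Proof.
move=> /spectral_posmx [hE _]; rewrite {1}hE /funmx.
rewrite -!mulmxA (mulmxA (spectralmx A)) mulmxV ?spectral_unit // mul1mx.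
rewrite mxtrace_mulC -!mulmxA mulmxV ?spectral_unit // mulmx1.
by apply: eq_bigr => i _; rewrite mul_diag_mx !mxE eqxx mulr1n.
Qed.

Lemma sqrtmx_posmx n (A : 'M[C]_n) : posmx A -> posmx (sqrtmx A).
Proof.
move=> /spectral_posmx [_ hD]; apply: unitary_conj_posmx.
  exact: spectral_unitarymx.
by move=> i; rewrite mxE sqrtC_ge0.
Qed.

Lemma sqrtmx_sqr n (A : 'M[C]_n) : posmx A -> sqrtmx A *m sqrtmx A = A.
Proof.
move=> /spectral_posmx [hE hD]; rewrite [RHS]hE /sqrtmx /funmx.
rewrite -!mulmxA (mulmxA (spectralmx A)) mulmxV ?spectral_unit // mul1mx.
rewrite !mulmxA; congr (_ *m _); rewrite -!mulmxA; congr (_ *m _).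
apply/matrixP => i j; rewrite mul_diag_mx !mxE.
case: eqP => [->|_]; last by rewrite !mulr0n mulr0.
by rewrite !mulr1n -expr2 sqrtCK.
Qed.

Lemma sqrtmx_uniq n (S : 'M[C]_n) : posmx S -> sqrtmx (S *m S) = S.
Proof.
move=> hS; have [hE hD] := spectral_posmx hS.
set U := spectralmx S in hE; set D := spectral_diag S in hE hD.
have uU : U \in unitmx by exact: spectral_unit.
have hSS : S *m S = invmx U *m diag_mx (map_mx (fun z => z ^+ 2) D) *m U.
  rewrite {1 2}hE -!mulmxA (mulmxA U) mulmxV // mul1mx.
  congr (_ *m _); rewrite !mulmxA; congr (_ *m _).
  apply/matrixP => i j; rewrite mul_diag_mx !mxE.
  by case: eqP => [->|_]; rewrite ?mulr1n ?expr2 // !mulr0n mulr0.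
rewrite /sqrtmx (funmxE _ _ uU hSS); last first.
  by apply: herm_normal; rewrite adjmxM posmx_herm.
rewrite [RHS]hE; congr (_ *m diag_mx _ *m _).
by apply/matrixP => i j; rewrite !mxE !ord1 exprCK //; exact: hD.
Qed.

(* With g(t) = 1 / sqrt t one has sqrt t = t g(t), so
   sqrt (A^* A) = A^* g(A A^* ) A, whose trace is that of sqrt (A A^* ). *)
Lemma trace_sqrtmx_gramC n (A : 'M[C]_n) :
  \tr (sqrtmx (A^t* *m A)) = \tr (sqrtmx (A *m A^t*)).
Proof.
have pos1 : posmx (A^t* *m A) by exact: posmx_gram.
have pos2 : posmx (A *m A^t*) by rewrite -{1}(trmxCK A); exact: posmx_gram.
pose g (z : C) := (sqrtC z)^-1.
have key (S : 'M[C]_n) : posmx S -> sqrtmx S = S *m funmx g S.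
  move=> hS; have [hE hD] := spectral_posmx hS; rewrite {2}hE /sqrtmx /funmx.
  rewrite -!mulmxA (mulmxA (spectralmx S)) mulmxV ?spectral_unit // mul1mx.
  rewrite !mulmxA; congr (_ *m _); rewrite -!mulmxA; congr (_ *m _).
  apply/matrixP => i j; rewrite mul_diag_mx !mxE /g.
  case: eqP => [->|_]; last by rewrite !mulr0n mulr0.
  rewrite !mulr1n; set z := spectral_diag S 0 j.
  have [->|z0] := eqVneq z 0; first by rewrite sqrtC0 mul0r.
  by rewrite -{2}(sqrtCK z) expr2 mulfK // sqrtC_eq0.
have hg : A *m funmx g (A^t* *m A) = funmx g (A *m A^t*) *m A.
  apply: intertwine_fun; [exact: spectral_unit|exact: spectral_unit|].
  by rewrite -(spectral_posmx pos1).1 -(spectral_posmx pos2).1 mulmxA.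
by rewrite !key // -mulmxA hg mulmxA mxtrace_mulC !mulmxA.
Qed.

Lemma posmx_mul_trace_ge0 n (A B : 'M[C]_n) :
  posmx A -> posmx B -> 0 <= \tr (A *m B).
Proof.
move=> hA hB; rewrite -(sqrtmx_sqr hA) -mulmxA mxtrace_mulC.
apply: posmx_trace_ge0; have := posmx_conj (sqrtmx A) hB.
by rewrite posmx_herm //; exact: sqrtmx_posmx.
Qed.

End LinearAlgebra.

(** * Kraus maps, projectors and gentle measurement *)

Section Kraus.
Local Open Scope sesquilinear_scope.
Variable C : numClosedFieldType.

Definition kraus (I : finType) m k (K : I -> 'M[C]_(k, m)) (X : 'M[C]_m) :
  'M[C]_k := \sum_i K i *m X *m (K i)^t*.

Lemma kraus_is_linear (I : finType) m k (K : I -> 'M[C]_(k, m)) :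
  linear (kraus K).
Proof.
move=> c X Y; rewrite /kraus scaler_sumr -big_split /=.
by apply: eq_bigr => i _; rewrite mulmxDr mulmxDl -scalemxAr -scalemxAl.
Qed.

HB.instance Definition _ (I : finType) m k (K : I -> 'M[C]_(k, m)) :=
  GRing.isLinear.Build C 'M[C]_m 'M[C]_k *:%R (kraus K) (kraus_is_linear K).

Lemma kraus_trace (I : finType) m k (K : I -> 'M[C]_(k, m)) X :
  \sum_i (K i)^t* *m K i = 1%:M -> \tr (kraus K X) = \tr X.
Proof.
move=> hK; rewrite /kraus raddf_sum /=.
under eq_bigr do rewrite -mulmxA mxtrace_mulC -mulmxA.
by rewrite -raddf_sum -mulmx_sumr hK mulmx1.
Qed.

Definition ampl (r m k : nat) (Phi : 'M[C]_m -> 'M[C]_k) (X : 'M[C]_(r * m)) :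
    'M[C]_(r * k) :=
  \matrix_(i, j)
    Phi (\matrix_(a, b)
           X (mxtens_index ((mxtens_unindex i).1, a))
             (mxtens_index ((mxtens_unindex j).1, b)))
        (mxtens_unindex i).2 (mxtens_unindex j).2.

Lemma sum_mxtens (r m : nat) (F : 'I_(r * m) -> C) :
  \sum_i F i = \sum_a \sum_b F (mxtens_index (a, b)).
Proof.
rewrite pair_big /=; apply: reindex; exists (@mxtens_unindex r m) => i _.
  by rewrite -surjective_pairing mxtens_indexK.
by rewrite -surjective_pairing mxtens_unindexK.
Qed.

(** Tensoring with the identity keeps the Kraus form, so complete positivity reduces to the
    positivity of conjugations. *)
Lemma ampl_kraus (I : finType) (r m k : nat) (K : I -> 'M[C]_(k, m)) X :
  @ampl r m k (kraus K) X
  = \sum_l ((1%:M : 'M[C]_r) *t K l) *m X *m ((1%:M : 'M[C]_r) *t K l)^t*.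
Proof.
apply/matrixP => i j; case: (mxtens_indexP i) => i1 i2.
case: (mxtens_indexP j) => j1 j2.
rewrite mxE /kraus !summxE; apply: eq_bigr => l _.
rewrite !mxtens_indexK /= mxE [RHS]mxE sum_mxtens.
have -> : forall Y : 'M[C]_(r * k, r * m),
   \sum_a \sum_b Y (mxtens_index (i1, i2)) (mxtens_index (a, b)) *
     ((1%:M *t K l) ^t* : 'M[C]_(r * m, r * k)) (mxtens_index (a, b))
       (mxtens_index (j1, j2))
   = \sum_b Y (mxtens_index (i1, i2)) (mxtens_index (j1, b)) * (K l j2 b)^*.
  move=> Y; rewrite (bigD1 j1) //= [X in _ + X]big1 ?addr0.
    apply: eq_bigr => b _; rewrite [X in _ * X]mxE [X in _ * Num.conj X]mxE.
    by rewrite tensmxE mxE eqxx mul1r.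
  move=> a ne; apply: big1 => b _.
  rewrite [X in _ * X]mxE [X in _ * Num.conj X]mxE tensmxE mxE.
  by rewrite eq_sym (negbTE ne) mul0r rmorph0 mulr0.
apply: eq_bigr => b _; congr (_ * _); last by rewrite !mxE.
rewrite mxE [RHS]mxE sum_mxtens (bigD1 i1) //= [X in _ + X]big1 ?addr0.
  by apply: eq_bigr => a _; rewrite tensmxE !mxE eqxx mul1r.
move=> a ne; apply: big1 => b' _.
by rewrite tensmxE mxE eq_sym (negbTE ne) !mul0r.
Qed.

Lemma ampl_kraus_posmx (I : finType) (r m k : nat) (K : I -> 'M[C]_(k, m)) X :
  posmx X -> posmx (@ampl r m k (kraus K) X).
Proof.
move=> hX; rewrite ampl_kraus; apply: posmx_sum => l _.
have := posmx_conj ((1%:M *t K l)^t* : 'M[C]_(r * m, r * k)) hX.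
by rewrite trmxCK.
Qed.

End Kraus.

Section Projectors.
Local Open Scope sesquilinear_scope.
Variable C : numClosedFieldType.

Definition is_proj n (P : 'M[C]_n) := P^t* = P /\ P *m P = P.

Lemma proj_posmx n (P : 'M[C]_n) : is_proj P -> posmx P.
Proof. by case=> h1 h2; have := posmx_gram P; rewrite h1 h2. Qed.

Lemma proj_sub n (P Q : 'M[C]_n) :
  is_proj P -> is_proj Q -> Q *m P = Q -> is_proj (P - Q).
Proof.
move=> [p1 p2] [q1 q2] h; have h' : P *m Q = Q.
  by rewrite -{1}q1 -p1 -adjmxM h q1.
split; first by rewrite adjmxB p1 q1.
by rewrite mulmxBr !mulmxBl p2 q2 h h' subrr subr0.
Qed.

Lemma is_proj1 n : is_proj (1%:M : 'M[C]_n).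
Proof. by split; rewrite ?adjmx1 ?mulmx1. Qed.

(** Subspaces are row spaces. The rows form an orthonormal basis, so this rectangular matrix
    compresses to a space of dimension the rank, and its adjoint is the isometry used by the
    decoder. *)
Definition onbasis m n (B : 'M[C]_(m, n)) : 'M[C]_(\rank B, n) :=
  schmidt (row_base B).

Lemma onbasis_unitary m n (B : 'M[C]_(m, n)) : onbasis B *m (onbasis B)^t* = 1%:M.
Proof. by apply/unitarymxP/schmidt_unitarymx; exact: rank_leq_col. Qed.

Lemma eqmx_onbasis m n (B : 'M[C]_(m, n)) : (onbasis B :=: B)%MS.
Proof.
apply: eqmx_trans (eq_row_base B); apply: eqmx_schmidt_free.
exact: row_base_free.
Qed.

Definition orthoproj m n (B : 'M[C]_(m, n)) : 'M[C]_n :=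
  (onbasis B)^t* *m onbasis B.

Lemma orthoproj_proj m n (B : 'M[C]_(m, n)) : is_proj (orthoproj B).
Proof.
split; first by rewrite adjmxM trmxCK.
by rewrite /orthoproj -mulmxA (mulmxA (onbasis B)) onbasis_unitary mul1mx.
Qed.

Lemma orthoproj_id m n p (B : 'M[C]_(m, n)) (A : 'M[C]_(p, n)) :
  (A <= B)%MS -> A *m orthoproj B = A.
Proof.
rewrite -(eqmx_onbasis B) => /submxP[D ->].
by rewrite /orthoproj -mulmxA (mulmxA (onbasis B)) onbasis_unitary mul1mx.
Qed.

Lemma orthoproj_nested m p n (B : 'M[C]_(m, n)) (B' : 'M[C]_(p, n)) :
  (B <= B')%MS -> orthoproj B *m orthoproj B' = orthoproj B.
Proof.
move=> h; apply: orthoproj_id; apply: submx_trans h.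
by rewrite -(eqmx_onbasis B) /orthoproj submxMl.
Qed.

Lemma orthoproj_trace m n (B : 'M[C]_(m, n)) : \tr (orthoproj B) = (\rank B)%:R.
Proof. by rewrite /orthoproj mxtrace_mulC onbasis_unitary mxtrace1. Qed.

(** Compression by W alone loses trace on the orthogonal complement. The branches [Some i] restore
    it by resetting each component there to the basis vector z, which is why the compressed spaces
    must be nonzero. *)
Definition enc_kraus c n (z : 'I_c) (W : 'M[C]_(c, n)) (i : option 'I_n) :
    'M[C]_(c, n) :=
  if i is Some i then delta_mx z 0 *m row i (1%:M - W^t* *m W) else W.

Lemma enc_kraus_sum c n (z : 'I_c) (W : 'M[C]_(c, n)) :
  W *m W^t* = 1%:M ->
  \sum_i (enc_kraus z W i)^t* *m enc_kraus z W i = 1%:M.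
Proof.
move=> hW; have pW : is_proj (W^t* *m W).
  by split; rewrite ?adjmxM ?trmxCK // -mulmxA (mulmxA W) hW mul1mx.
have [t1 t2] := proj_sub (is_proj1 n) pW (mulmx1 _).
set T := 1%:M - _ in t1 t2; have hT : W^t* *m W + T = 1%:M.
  by rewrite /T addrC subrK.
rewrite (bigD1 None) //= (reindex_omap some id) /=; last by case.
under eq_bigl do rewrite eqxx.
rewrite -/T -[RHS]hT; congr (_ + _); move: T t1 t2 {hT} => T t1 t2.
transitivity (T^t* *m T); last by rewrite t1 t2.
apply/matrixP => a b.
rewrite summxE mxE; apply: eq_bigr => i _.
rewrite adjmxM mulmxA -(mulmxA _ _ (delta_mx z 0)).
have -> : (delta_mx z 0 : 'cV[C]_c)^t* *m delta_mx z 0 = 1%:M.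
  apply/matrixP => x y; rewrite !ord1 mxE (bigD1 z) //= big1 ?addr0.
    by rewrite !mxE !eqxx rmorph1 mulr1.
  by move=> w ne; rewrite !mxE (negbTE ne) /= mulr0.
by rewrite mulmx1 mxE big_ord1 !mxE.
Qed.

(** On an operator supported on the subspace the reset branches vanish, so all the disturbance of
    the code comes from the measurement. *)
Lemma enc_dec_kraus c n (z : 'I_c) (W : 'M[C]_(c, n)) (X : 'M[C]_n) :
  W^t* *m W *m X = X -> X *m (W^t* *m W) = X ->
  kraus (fun _ : unit => W^t* ) (kraus (enc_kraus z W) X) = X.
Proof.
move=> h1 h2; have -> : kraus (enc_kraus z W) X = W *m X *m W^t*.
  rewrite /kraus (bigD1 None) //= big1 ?addr0 // => -[i|] // _ /=.
  rewrite -!mulmxA [X in _ *m X](_ : _ = 0) ?mulmx0 // mulmxA.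
  by rewrite -row_mul mulmxBl mul1mx h1 subrr row0 mul0mx.
rewrite /kraus (bigD1 tt) //= big1 ?addr0; last by case.
by rewrite trmxCK !mulmxA h1 -mulmxA h2.
Qed.

Lemma dec_kraus_sum c n (W : 'M[C]_(c, n)) : W *m W^t* = 1%:M ->
  \sum_(i : unit) (W^t* )^t* *m W^t* = 1%:M.
Proof.
by move=> hW; rewrite (bigD1 tt) //= big1 ?addr0 ?trmxCK //; case.
Qed.

Lemma sqrtmx_scale_proj n (a : C) (Q : 'M[C]_n) : 0 <= a -> is_proj Q ->
  sqrtmx (a *: Q) = sqrtC a *: Q.
Proof.
move=> a0 pQ; rewrite -[RHS]sqrtmx_uniq.
  by rewrite -scalemxAl -scalemxAr scalerA -expr2 sqrtCK pQ.2.
by apply: posmxZ; [rewrite sqrtC_ge0|exact: proj_posmx].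
Qed.

(* The fidelity is computed from A A^* = (sqrt a *: sqrt rho Q sqrt rho)^2. *)
Lemma fidelity_proj n (a : C) (rho Q : 'M[C]_n) :
  posmx rho -> is_proj Q -> 0 <= a ->
  let A := sqrtmx rho *m sqrtmx (a *: (Q *m rho *m Q)) in
  \tr (sqrtmx (A^t* *m A)) = sqrtC a * \tr (Q *m rho).
Proof.
move=> hr pQ a0 A; rewrite trace_sqrtmx_gramC.
have hs : posmx (a *: (Q *m rho *m Q)).
  by apply: posmxZ => //; rewrite -{1}pQ.1; exact: posmx_conj.
pose S := sqrtmx rho *m Q *m sqrtmx rho.
have hS : posmx S.
  have := posmx_conj (sqrtmx rho) (proj_posmx pQ).
  by rewrite posmx_herm //; exact: sqrtmx_posmx.
have -> : A *m A^t* = (sqrtC a *: S) *m (sqrtC a *: S).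
  rewrite -scalemxAl -scalemxAr scalerA -expr2 sqrtCK.
  rewrite /A adjmxM !(posmx_herm (sqrtmx_posmx _)) //.
  rewrite mulmxA -(mulmxA (sqrtmx rho)) sqrtmx_sqr // /S.
  rewrite -scalemxAr -scalemxAl; congr (_ *: _).
  by rewrite -{2}(sqrtmx_sqr hr) !mulmxA.
rewrite sqrtmx_uniq; last by apply: posmxZ; rewrite ?sqrtC_ge0.
by rewrite mxtraceZ /S mxtrace_mulC mulmxA sqrtmx_sqr // mxtrace_mulC.
Qed.

End Projectors.

(** * Type classes and tensor powers *)

Section Types.

(** The histogram of a sequence. Counts are bounded in the codomain, so that [card_ffun] gives the
    polynomial bound n.+1 ^ #|X| on the number of types. *)
Definition ftype (X : finType) n (f : {ffun 'I_n -> X}) :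
    {ffun X -> 'I_n.+1} :=
  [ffun x => inord #|[set t | f t == x]%SET|].

Lemma ftypeE (X : finType) n (f : {ffun 'I_n -> X}) x :
  ftype f x = #|[set t | f t == x]%SET| :> nat.
Proof.
by rewrite ffunE inordK // ltnS (leq_trans (max_card _)) // card_ord.
Qed.

Lemma prod_ftype (S : comPzSemiRingType) (X : finType) n (q : X -> S)
    (f : {ffun 'I_n -> X}) :
  \prod_t q (f t) = \prod_x q x ^+ ftype f x.
Proof.
rewrite (partition_big (fun t => f t) xpredT) //=; apply: eq_bigr => x _.
rewrite ftypeE (eq_bigr (fun _ => q x)); last by move=> t /eqP ->.
by rewrite prodr_const; congr (_ ^+ _); apply: eq_card => t; rewrite inE.
Qed.

Definition class_size (X : finType) n (f : {ffun 'I_n -> X}) : nat :=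
  #|[set g : {ffun 'I_n -> X} | ftype g == ftype f]%SET|.

(* The members of a type class are equally likely, so a sequence of probability
   t has a class of at most 1 / t members, whatever the distribution. *)
Lemma class_size_prob (F : numFieldType) (X : finType) n (q : X -> F)
    (f : {ffun 'I_n -> X}) :
  (forall x, 0 <= q x) -> \sum_x q x = 1 ->
  (class_size f)%:R * \prod_t q (f t) <= 1.
Proof.
move=> q0 q1.
apply: (@le_trans _ _ (\sum_(g : {ffun 'I_n -> X}) \prod_t q (g t))); last first.
  rewrite -(bigA_distr_bigA (fun _ : 'I_n => q)) /= (eq_bigr (fun=> 1)) //.
  by rewrite prodr_const expr1n.
rewrite (bigID (fun g => ftype g == ftype f)) /=.
rewrite [X in _ <= X + _](eq_bigr (fun=> \prod_t q (f t))); last first.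
  by move=> g /eqP e; rewrite !prod_ftype e.
rewrite sumr_const -[X in _ <= X + _]mulr_natl; set c := #|_|.
have -> : c = class_size f by apply: eq_card => g; rewrite inE.
by rewrite lerDl sumr_ge0 // => g _; apply: prodr_ge0.
Qed.

(** Each of the at most n.+1 ^ #|X| type classes lies entirely inside or outside this set, and
    contributes at most k sequences. *)
Lemma card_class_size_le (X : finType) n (k : nat) :
  (#|[set f : {ffun 'I_n -> X} | class_size f <= k]%SET| <= n.+1 ^ #|X| * k)%N.
Proof.
rewrite -sum1_card (partition_big (@ftype X n) xpredT) //=.
have -> : (n.+1 ^ #|X| * k = \sum_(tau : {ffun X -> 'I_n.+1}) k)%N.
  by rewrite sum_nat_const card_ffun card_ord.
apply: leq_sum => tau _; rewrite sum1_card.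
case: (pickP (fun f : {ffun 'I_n -> X} =>
    (f \in [set f | (class_size f <= k)%N]%SET) && (ftype f == tau))) => [f|h].
  rewrite inE => /andP[hf /eqP e]; apply: leq_trans hf.
  by apply: subset_leq_card; apply/fintype.subsetP => g; rewrite !inE e => /andP[].
by rewrite eq_card0.
Qed.

End Types.

Section Tensor.
Local Open Scope sesquilinear_scope.
Variables (C : numClosedFieldType) (d n : nat).
Local Notation N := (pow_dim d n).

Lemma basis_index_inj : injective (@basis_index d n).
Proof. exact: enum_val_inj. Qed.

Lemma basis_indexK (f : {ffun 'I_n -> 'I_d}) : basis_index (enum_rank f) = f.
Proof. exact: enum_rankK. Qed.

Lemma sum_basis (V : nmodType) (F : {ffun 'I_n -> 'I_d} -> V) :
  \sum_(a : 'I_N) F (basis_index a) = \sum_f F f.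
Proof.
rewrite [RHS](reindex (@basis_index d n)) //=.
by exists enum_rank => i _; [exact: enum_valK|exact: enum_rankK].
Qed.

Definition tens (rho : 'I_n -> 'M[C]_d) : 'M[C]_N :=
  \matrix_(a, b) \prod_(t < n) rho t (basis_index a t) (basis_index b t).

Lemma tens_mul (A B : 'I_n -> 'M[C]_d) :
  tens A *m tens B = tens (fun t => A t *m B t).
Proof.
apply/matrixP => a b; rewrite !mxE.
under eq_bigr do rewrite !mxE -big_split /=.
rewrite (sum_basis (fun f => \prod_(t < n)
  (A t (basis_index a t) (f t) * B t (f t) (basis_index b t)))).
rewrite -(bigA_distr_bigA (fun t c =>
  A t (basis_index a t) c * B t c (basis_index b t))).
by apply: eq_bigr => t _; rewrite mxE.
Qed.

Lemma eq_tens (A B : 'I_n -> 'M[C]_d) : A =1 B -> tens A = tens B.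
Proof.
by move=> e; apply/matrixP => a b; rewrite !mxE; apply: eq_bigr => t _; rewrite e.
Qed.

Lemma tens_adj (A : 'I_n -> 'M[C]_d) : (tens A)^t* = tens (fun t => (A t)^t* ).
Proof.
by apply/matrixP => a b; rewrite !mxE rmorph_prod; apply: eq_bigr => t _; rewrite !mxE.
Qed.

Lemma tens_diag (D : 'rV[C]_d) :
  tens (fun=> diag_mx D)
  = diag_mx (\row_(a < N) \prod_(t < n) D 0 (basis_index a t)).
Proof.
apply/matrixP => a b; rewrite !mxE.
have [->|ne] := eqVneq a b.
  by rewrite mulr1n; apply: eq_bigr => t _; rewrite mxE eqxx.
have [t ht] : exists t, basis_index a t != basis_index b t.
  apply/existsP; apply: contraR ne; rewrite negb_exists => /forallP h.
  by apply/eqP/basis_index_inj/ffunP => t; apply/eqP; have := h t; rewrite negbK.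
by rewrite mulr0n (bigD1 t) //= mxE (negbTE ht) mulr0n mul0r.
Qed.

Lemma tens1 : tens (fun=> 1%:M) = 1%:M.
Proof.
have -> : tens (fun=> 1%:M) = tens (fun=> diag_mx (const_mx 1)).
  by apply: eq_tens => t; rewrite diag_const_mx.
rewrite tens_diag -diag_const_mx; congr diag_mx; apply/matrixP => i a.
by rewrite !mxE big1 // => t _; rewrite mxE.
Qed.

Lemma tens_trace (A : 'I_n -> 'M[C]_d) : \tr (tens A) = \prod_t \tr (A t).
Proof.
rewrite /mxtrace (eq_bigr (fun a : 'I_N =>
  \prod_t A t (basis_index a t) (basis_index a t))); last first.
  by move=> a _; rewrite mxE.
rewrite (sum_basis (fun f => \prod_t A t (f t) (f t))).
by rewrite -(bigA_distr_bigA (fun t c => A t c c)).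
Qed.

Lemma tens_posmx (A : 'I_n -> 'M[C]_d) :
  (forall t, posmx (A t)) -> posmx (tens A).
Proof.
move=> hA; have -> : tens A = (tens (fun t => sqrtmx (A t)))^t*
    *m tens (fun t => sqrtmx (A t)).
  rewrite tens_adj tens_mul; apply: eq_tens => t.
  by rewrite (posmx_herm (sqrtmx_posmx (hA t))) sqrtmx_sqr.
exact: posmx_gram.
Qed.

Lemma tens_sum (I : finType) (A : 'I_n -> I -> 'M[C]_d) :
  tens (fun t => \sum_i A t i)
  = \sum_(f : {ffun 'I_n -> I}) tens (fun t => A t (f t)).
Proof.
apply/matrixP => a b; rewrite summxE mxE.
under eq_bigr do rewrite summxE.
rewrite (bigA_distr_bigA (fun t i => A t i (basis_index a t) (basis_index b t))).
by apply: eq_bigr => f _; rewrite mxE.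
Qed.

(** Expand the power of B = A + (B - A): besides the power of A, all terms are tensor products of
    positive matrices. *)
Lemma tens_le (A B : 'M[C]_d) :
  posmx A -> posmx (B - A) -> posmx (tens (fun=> B) - tens (fun=> A)).
Proof.
move=> hA hB; pose S (b : bool) := if b then A else B - A.
have -> : tens (fun=> B) = tens (fun=> \sum_b S b).
  by apply: eq_tens => t; rewrite big_bool /= addrC subrK.
rewrite (tens_sum (fun=> S)) (bigD1 [ffun=> true]) //=.
rewrite (_ : tens _ = tens (fun=> A)); last first.
  by apply: eq_tens => t; rewrite ffunE.
rewrite addrC addrK; apply: posmx_sum => f _; apply: tens_posmx => t.
by rewrite /S; case: (f t).
Qed.

Lemma tens_scale (c : 'I_n -> C) (A : 'I_n -> 'M[C]_d) :
  tens (fun t => c t *: A t) = (\prod_t c t) *: tens A.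
Proof.
apply/matrixP => a b; rewrite !mxE -big_split /=.
by apply: eq_bigr => t _; rewrite mxE.
Qed.

Definition pair_index (a b : 'I_N) : {ffun 'I_n -> 'I_d * 'I_d} :=
  [ffun t => (basis_index a t, basis_index b t)].

Definition type_mx (tau : {ffun 'I_d * 'I_d -> 'I_n.+1}) : 'M[C]_N :=
  \matrix_(a, b) (ftype (pair_index a b) == tau)%:R.

(** The (a, b) entry of a tensor power is a product over the pairs (a_t, b_t), so it depends on
    their joint type only. *)
Lemma tens_type_mx (A : 'M[C]_d) :
  tens (fun=> A) = \sum_(tau : {ffun 'I_d * 'I_d -> 'I_n.+1})
      (\prod_x A x.1 x.2 ^+ tau x) *: type_mx tau.
Proof.
apply/matrixP => a b; rewrite summxE (bigD1 (ftype (pair_index a b))) //=.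
rewrite [X in _ + X]big1 ?addr0; last first.
  by move=> tau ne; rewrite !mxE eq_sym (negbTE ne) mulr0.
rewrite !mxE eqxx mulr1 -(prod_ftype (fun x => A x.1 x.2)).
by apply: eq_bigr => t _; rewrite ffunE.
Qed.

(* Every A^{(x) n} lies in the span of the polynomially many type matrices, so
   this single space, of dimension #|J| up to a polynomial factor, contains the
   rows indexed by J of all tensor powers at once. *)
Definition univ_space (J : pred {ffun 'I_n -> 'I_d}) : 'M[C]_N :=
  (\sum_(p : 'I_N * {ffun 'I_d * 'I_d -> 'I_n.+1} | J (basis_index p.1))
     <<row p.1 (type_mx p.2)>>)%MS.

Lemma univ_space_row (J : pred {ffun 'I_n -> 'I_d}) (A : 'M[C]_d) a : J (basis_index a) ->
  (row a (tens (fun=> A)) <= univ_space J)%MS.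
Proof.
move=> hJ; rewrite tens_type_mx linear_sum /=; apply: summx_sub => tau _.
rewrite linearZ /=; apply: scalemx_sub.
rewrite -[X in (X <= _)%MS]/(row (a, tau).1 (type_mx (a, tau).2)).
by rewrite -genmxE /univ_space (sumsmx_sup (a, tau)).
Qed.

Lemma univ_spaceS (J J' : pred {ffun 'I_n -> 'I_d}) :
  (forall f, J f -> J' f) -> (univ_space J <= univ_space J')%MS.
Proof.
move=> h; apply/sumsmx_subP => p hp; rewrite /univ_space (sumsmx_sup p) //.
exact: h.
Qed.

Lemma rank_univ_space (J : pred {ffun 'I_n -> 'I_d}) :
  (\rank (univ_space J) <= #|[set f | J f]%SET| * n.+1 ^ (d * d))%N.
Proof.
apply: (@leq_trans (\sum_(p : 'I_N * {ffun 'I_d * 'I_d -> 'I_n.+1} |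
    J (basis_index p.1)) 1)).
  apply: (leq_trans (mxrank_sum_leqif _)) => /=; apply: leq_sum => p _ /=.
  by rewrite mxrank_gen rank_leq_row.
rewrite sum1_card -[X in (_ * X)%N](_ : #|{ffun 'I_d * 'I_d -> 'I_n.+1}| = _);
  last by rewrite card_ffun card_prod !card_ord.
rewrite -cardsT -cardsX -(card_imset _ (f := fun p : 'I_N * {ffun 'I_d * 'I_d -> 'I_n.+1} =>
   (basis_index p.1, p.2))); last first.
  by move=> [a s] [b s'] [/basis_index_inj -> ->].
apply: subset_leq_card; apply/fintype.subsetP => q /imsetP[p hp ->].
by rewrite inE /= !inE andbT.
Qed.

Section Spectrum.
Variables (A : 'M[C]_d) (P : 'M[C]_N).
Hypotheses (hA : posmx A) (hP : is_proj P).
Local Notation U := (spectralmx A).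
Local Notation V := (tens (fun=> U)).

(** Through these diagonal entries in the tensor eigenbasis of A, the trace of P against the tensor
    power of A becomes a classical sum: a weight with values in [0, 1] and total Tr P, summed
    against products of eigenvalues. *)
Definition spectral_weight (a : 'I_N) : C := (V *m P *m V^t*) a a.

Lemma tens_unitary : V *m V^t* = 1%:M.
Proof.
rewrite tens_adj tens_mul -tens1; apply: eq_tens => t.
by apply/unitarymxP/spectral_unitarymx.
Qed.

Lemma trace_tens_spectral :
  \tr (P *m tens (fun=> A))
  = \sum_a (\prod_t spectral_diag A 0 (basis_index a t)) * spectral_weight a.
Proof.
have -> : tens (fun=> A) = V^t* *m
    diag_mx (\row_(a < N) \prod_(t < n) spectral_diag A 0 (basis_index a t)) *m V.
  rewrite -tens_diag tens_adj !tens_mul; apply: eq_tens => t.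
  by rewrite {1}(spectral_posmx hA).1 invmx_unitary // spectral_unitarymx.
rewrite mulmxA mxtrace_mulC !mulmxA mxtrace_mulC; apply: eq_bigr => a _.
by rewrite mul_diag_mx mxE [X in X * _]mxE.
Qed.

Lemma spectral_weight_sum : \sum_a spectral_weight a = \tr P.
Proof.
rewrite -[LHS]/(\tr _) mxtrace_mulC mulmxA.
by rewrite (mulmx1C tens_unitary) mul1mx.
Qed.

Lemma spectral_weight_ge0 a : 0 <= spectral_weight a.
Proof.
rewrite /spectral_weight -quad_delta -{1}(trmxCK V).
exact: (posmx_conj (V^t* ) (proj_posmx hP)).
Qed.

Lemma spectral_weight_le1 a : spectral_weight a <= 1.
Proof.
rewrite -subr_ge0.
have -> : 1 - spectral_weight a = (V *m (1%:M - P) *m V^t*) a a.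
  rewrite mulmxBr mulmxBl mulmx1 tens_unitary.
  by rewrite [RHS]mxE [X in _ = X + _]mxE [X in _ = _ + X]mxE eqxx.
have pP : is_proj (1%:M - P) by apply: proj_sub (is_proj1 _ _) hP (mulmx1 _).
rewrite -quad_delta -{1}(trmxCK V).
exact: (posmx_conj (V^t* ) (proj_posmx pP)).
Qed.

Lemma spectral_weight1 a : row a V *m P = row a V -> spectral_weight a = 1.
Proof.
move=> h; have -> : spectral_weight a = (row a V *m P *m V^t*) 0 a.
  by rewrite -!row_mul [RHS]mxE.
by rewrite h -row_mul tens_unitary !mxE eqxx.
Qed.

End Spectrum.

End Tensor.

(** * Typical sequences *)

Section TypicalSequences.
Variables (R : realType) (X : finType).
Implicit Types l Z : X -> R.

Lemma sum_prod_ffun l n : \sum_x l x = 1 ->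
  \sum_(f : {ffun 'I_n -> X}) \prod_t l (f t) = 1.
Proof.
move=> l1; rewrite -(bigA_distr_bigA (fun _ : 'I_n => l)) /=.
by rewrite (eq_bigr (fun=> 1)) // prodr_const expr1n.
Qed.

Lemma second_moment l Z n : \sum_x l x = 1 -> \sum_x l x * Z x = 0 ->
  \sum_(f : {ffun 'I_n -> X}) (\prod_t l (f t)) * (\sum_t Z (f t)) ^+ 2
  = n%:R * \sum_x l x * Z x ^+ 2.
Proof.
move=> l1 lZ.
(* [F t u s] is the factor at coordinate s of the term Z (f t) * Z (f u). In product form the sum
   over f factorises, and the terms with t != u vanish because Z has mean 0. *)
pose F (t u s : 'I_n) x :=
  l x * (if s == t then Z x else 1) * (if s == u then Z x else 1).
have prod_if (t : 'I_n) (f : {ffun 'I_n -> X}) :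
    \prod_s (if s == t then Z (f s) else 1) = Z (f t).
  rewrite (bigD1 t) //= eqxx big1 ?mulr1 // => s ne.
  by rewrite (negbTE ne).
transitivity (\sum_t \sum_u \sum_(f : {ffun 'I_n -> X}) \prod_s F t u s (f s)).
  rewrite (eq_bigr (fun f : {ffun 'I_n -> X} =>
      \sum_t \sum_u \prod_s F t u s (f s))).
    by rewrite exchange_big; apply: eq_bigr => t _; rewrite exchange_big.
  move=> f _; rewrite expr2 mulr_suml mulr_sumr; apply: eq_bigr => t _.
  rewrite mulr_sumr mulr_sumr; apply: eq_bigr => u _.
  by rewrite /F !big_split /= !prod_if mulrA.
have hF t u : \sum_(f : {ffun 'I_n -> X}) \prod_s F t u s (f s)
    = if u == t then \sum_x l x * Z x ^+ 2 else 0.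
  rewrite -(bigA_distr_bigA (F t u)) (bigD1 t) //=.
  case: eqVneq => [->|ne].
    rewrite [X in _ * X]big1 ?mulr1.
      by apply: eq_bigr => x _; rewrite /F eqxx expr2 mulrA.
    move=> s ne; rewrite -[RHS]l1; apply: eq_bigr => x _.
    by rewrite /F (negbTE ne) !mulr1.
  rewrite (eq_bigr (fun x => l x * Z x)) ?lZ ?mul0r // => x _.
  by rewrite /F eqxx eq_sym (negbTE ne) mulr1.
under eq_bigr do under eq_bigr do rewrite hF.
under eq_bigr do rewrite -big_mkcond big_pred1_eq.
by rewrite sumr_const card_ord mulr_natl.
Qed.

Lemma chebyshev_sum l Z n (a : R) : (forall x, 0 <= l x) ->
  \sum_x l x = 1 -> \sum_x l x * Z x = 0 -> 0 < a ->
  \sum_(f : {ffun 'I_n -> X} | a <= `|\sum_t Z (f t)|) \prod_t l (f t)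
  <= n%:R * (\sum_x l x * Z x ^+ 2) / a ^+ 2.
Proof.
move=> l0 l1 lZ a0; rewrite ler_pdivlMr ?exprn_gt0 // -second_moment //.
rewrite mulr_suml [X in _ <= X](bigID (fun f : {ffun 'I_n -> X} =>
  a <= `|\sum_t Z (f t)|)) /= -[X in X <= _]addr0; apply: lerD; last first.
  by apply: sumr_ge0 => f _; rewrite mulr_ge0 ?sqr_ge0 ?prodr_ge0.
apply: ler_sum => f hf; apply: ler_wpM2l; first exact: prodr_ge0.
rewrite -[X in _ <= X]real_normK ?num_real //.
by rewrite ler_pXn2r // nnegrE ?normr_ge0 // ltW.
Qed.

Definition shannon l : R := - \sum_x l x * ln (l x).

Definition ln_variance l : R := \sum_x l x * (- ln (l x) - shannon l) ^+ 2.

Lemma ln_variance_ge0 l : (forall x, 0 <= l x) -> 0 <= ln_variance l.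
Proof. by move=> l0; apply: sumr_ge0 => x _; rewrite mulr_ge0 ?sqr_ge0. Qed.

Lemma ln_prod (I : finType) (F : I -> R) : (forall i, 0 < F i) ->
  ln (\prod_i F i) = \sum_i ln (F i).
Proof.
move=> F0; suff [_ ->] : 0 < \prod_i F i /\ ln (\prod_i F i) = \sum_i ln (F i).
  by [].
apply: (big_rec2 (fun a b => 0 < a /\ ln a = b)); first by rewrite ln1.
by move=> i a b _ [a0 <-]; rewrite mulr_gt0 // lnM // posrE.
Qed.

(** Each term satisfies - x ln x <= 1 - x, by ln y <= y - 1 at y = 1/x. This is weaker than ln #|X|,
    but the grid is long enough for it. *)
Lemma shannon_le_card l : (forall x, 0 <= l x) -> shannon l <= #|X|%:R.
Proof.
move=> l0; rewrite /shannon -sumrN -sum1_card natr_sum; apply: ler_sum => x _.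
have [h|lx0] := leP (l x) 0; first by rewrite (@ln0 _ (l x)) // mulr0 oppr0.
have := @le_ln1Dx R ((l x)^-1 - 1).
rewrite ltrBrDr addrC subrr invr_gt0 lx0 addrC subrK => /(_ isT).
rewrite lnV ?posrE // => h; have := ler_wpM2l (l0 x) h.
rewrite mulrBr mulfV ?gt_eqF // mulrN mulr1 => h'.
by rewrite mulr1n; lra.
Qed.

Section Source.
Variables (l : X -> R) (n : nat) (delta : R).
Hypotheses (l0 : forall x, 0 <= l x) (l1 : \sum_x l x = 1).
Hypotheses (n0 : (0 < n)%N) (delta0 : 0 < delta).

Let p (f : {ffun 'I_n -> X}) := \prod_t l (f t).

(** Chebyshev's inequality in the form shared by both tails below. The hypothesis is restricted to p
    f > 0 because [ln] of 0 is 0 and says nothing about the deviation; sequences of probability 0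
    add nothing to the sum. *)
Let sum_prod_dev (Q : pred {ffun 'I_n -> X}) :
  (forall f, Q f -> 0 < p f -> n%:R * delta <= `|n%:R * shannon l + ln (p f)|) ->
  \sum_(f | Q f) p f <= ln_variance l / (n%:R * delta ^+ 2).
Proof.
move=> hQ; pose Z x := - ln (l x) - shannon l.
have nd0 : 0 < n%:R * delta :> R by rewrite mulr_gt0 // ltr0n.
have lZ : \sum_x l x * Z x = 0.
  rewrite /Z; under eq_bigr do rewrite mulrBr mulrN.
  by rewrite big_split /= !sumrN -mulr_suml l1 mul1r subrr.
have -> : ln_variance l / (n%:R * delta ^+ 2)
    = n%:R * (\sum_x l x * Z x ^+ 2) / (n%:R * delta) ^+ 2.
  rewrite -/(ln_variance l); field.
  by rewrite gt_eqF //= pnatr_eq0 -lt0n.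
apply: le_trans (chebyshev_sum n l0 l1 lZ nd0).
rewrite [X in X <= _]big_mkcond [X in _ <= X]big_mkcond /=.
apply: ler_sum => f _; have p0 : 0 <= p f by apply: prodr_ge0.
case: ifP => [Qf|_]; last by case: ifP.
case: ifP => // /negP hZ; have [h//|pf] := leP (p f) 0.
case: hZ; have := hQ f Qf pf.
have lf t : 0 < l (f t).
  rewrite lt_neqAle l0 andbT; apply/eqP => e; move: pf.
  by rewrite /p (bigD1 t) //= -e mul0r ltxx.
rewrite /p ln_prod // => h.
have -> : \sum_t Z (f t) = - (n%:R * shannon l + \sum_t ln (l (f t))).
  by rewrite /Z sumrB sumrN sumr_const card_ord -[in LHS]mulr_natl; ring.
by rewrite normrN.
Qed.

Lemma typical_prob (r : R) : shannon l + delta <= r ->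
  1 - ln_variance l / (n%:R * delta ^+ 2)
  <= \sum_(f : {ffun 'I_n -> X} | expR (- (n%:R * r)) <= p f) p f.
Proof.
move=> hr; have := sum_prod_ffun n l1.
rewrite (bigID (fun f => expR (- (n%:R * r)) <= p f)) /= => h1.
rewrite lerBlDr -[X in X <= _]h1 lerD2l.
apply: sum_prod_dev => f; rewrite -ltNge => hf pf.
rewrite -[X in X < _]lnK ?posrE // ltr_expR in hf.
have : n%:R * (shannon l + delta) <= n%:R * r by apply: ler_wpM2l.
have nd : 0 < n%:R * delta by rewrite mulr_gt0 // ltr0n.
rewrite mulrDr => h; rewrite ler0_norm; lra.
Qed.

Lemma large_prob (r : R) : r <= shannon l - delta ->
  \sum_(f : {ffun 'I_n -> X} | expR (- (n%:R * r)) < p f) p f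
  <= ln_variance l / (n%:R * delta ^+ 2).
Proof.
move=> hr; apply: sum_prod_dev => f hf pf.
rewrite -[X in _ < X]lnK ?posrE // ltr_expR in hf.
have : n%:R * r <= n%:R * (shannon l - delta) by apply: ler_wpM2l.
have nd : 0 < n%:R * delta by rewrite mulr_gt0 // ltr0n.
rewrite mulrBr => h; rewrite ger0_norm; lra.
Qed.

(** Sequences above the threshold e^{-nr} are rare by [large_prob]; on the others p is at most the
    threshold, which multiplies the total weight, later the dimension of a subspace. *)
Lemma weighted_large_prob (w : {ffun 'I_n -> X} -> R) (r : R) :
  (forall f, 0 <= w f <= 1) -> r <= shannon l - delta ->
  \sum_f p f * w f
  <= ln_variance l / (n%:R * delta ^+ 2) + expR (- (n%:R * r)) * \sum_f w f.
Proof.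
move=> hw hr; rewrite (bigID (fun f => expR (- (n%:R * r)) < p f)) /=.
apply: lerD.
  apply: le_trans (large_prob hr); apply: ler_sum => f _.
  have /andP[_ w1] := hw f; rewrite -[X in _ <= X]mulr1.
  by apply: ler_wpM2l => //; apply: prodr_ge0.
rewrite mulr_sumr big_mkcond /=; apply: ler_sum => f _.
have /andP[w0 _] := hw f; case: ifPn; last by rewrite mulr_ge0 ?expR_ge0.
by rewrite -leNgt => h; apply: ler_wpM2r.
Qed.

End Source.
End TypicalSequences.

(** * Randomly shifted grids *)

Section ShiftedGrid.

(** Cell 0 has no lower end, so the cells telescope to the top value. Values in a [zmodType] let one
    definition serve the projectors and their masses. *)
Definition cell (V : zmodType) (x : nat -> V) (M s k : nat) : V :=
  x (s + k * M)%N - (if k is k'.+1 then x (s + k' * M)%N else 0).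

Lemma cell_sum (V : zmodType) (x : nat -> V) (M s K : nat) :
  \sum_(k < K.+1) cell x M s k = x (s + K * M)%N.
Proof.
elim: K => [|K IH]; first by rewrite big_ord1 /cell subr0.
by rewrite big_ord_recr /= IH /cell addrC subrK.
Qed.

(* The least k with j <= s + k M. *)
Definition cell_of (M j s : nat) : nat := ((j + (M.-1 - s)) %/ M)%N.

Lemma cell_of_ge M j s : (s < M)%N -> (j <= s + cell_of M j s * M)%N.
Proof.
move=> hs; rewrite /cell_of.
have := divn_eq (j + (M.-1 - s)) M; have := ltn_pmod (j + (M.-1 - s)) (leq_ltn_trans (leq0n s) hs).
lia.
Qed.

Lemma cell_of_lt M j s k : (s < M)%N -> cell_of M j s = k.+1 ->
  (s + k * M < j)%N.
Proof.
move=> hs; rewrite /cell_of => e.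
have := divn_eq (j + (M.-1 - s)) M; rewrite e mulSn; lia.
Qed.

Lemma cell_of_lt_add M j s : (s < M)%N -> (s + cell_of M j s * M < j + M)%N.
Proof.
move=> hs; case e: (cell_of M j s) => [|k]; first by rewrite mul0n; lia.
by have := cell_of_lt hs e; rewrite mulSn; lia.
Qed.

Lemma cell_of_le M j s K : (s < M)%N -> (j <= K * M)%N -> (cell_of M j s <= K)%N.
Proof.
move=> hs hj; rewrite leqNgt; apply/negP => hK.
case e: (cell_of M j s) hK => [//|k] hK.
have := cell_of_lt hs e; have : (K * M <= k * M)%N by rewrite leq_mul2r -ltnS hK orbT.
lia.
Qed.

(* Each of the a.+1 values just below j is s + (k - 1) M for at most one s. *)
Lemma card_bad_shift M j a :
  (#|[set s : 'I_M | if cell_of M j s is k.+1 then j <= s + k * M + a.+1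
                     else false]%SET| <= a.+1)%N.
Proof.
set A := [set s | _]%SET; pose g (s : 'I_M) := (s + (cell_of M j s).-1 * M)%N.
rewrite cardE -(size_map g) -(size_iota (j - a.+1) a.+1).
apply: uniq_leq_size.
  rewrite map_inj_in_uniq ?enum_uniq // => s s' _ _ e; apply: val_inj => /=.
  have := congr1 (fun i => i %% M)%N e.
  by rewrite /g !(addnC (nat_of_ord _)) !modnMDl !modn_small.
move=> i /mapP[s]; rewrite mem_enum inE /g => hs ->.
case e: (cell_of M j s) hs => [//|k] hs.
have := cell_of_lt (ltn_ord s) e; rewrite mem_iota /=; lia.
Qed.

(** For a good shift the cell of j ends at or above j, where x >= 1 - eta, and starts below the
    transition zone, where x <= eta, so it misses at most 2 eta. A bad shift misses at most 1 more,
    and at most a.+1 shifts are bad. *)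
Lemma shift_average (R : realFieldType) (M j a : nat) (x : nat -> R) (eta : R) :
  (forall i, 0 <= x i <= 1) -> 0 <= eta ->
  (forall i, (j <= i)%N -> 1 - eta <= x i) ->
  (forall i, (i + a.+1 < j)%N -> x i <= eta) ->
  \sum_(s < M) (1 - cell x M s (cell_of M j s)) <= M%:R * (2 * eta) + a.+1%:R.
Proof.
move=> x01 eta0 hup hlo.
pose A := [set s : 'I_M | if cell_of M j s is k.+1 then (j <= s + k * M + a.+1)%N
                     else false]%SET.
apply: (@le_trans _ _ (\sum_(s < M) (2 * eta + (s \in A)%:R))).
  apply: ler_sum => s _; rewrite /cell inE.
  have h1 := hup _ (cell_of_ge j (ltn_ord s)).
  case e: (cell_of M j s) h1 => [|k] h1; first by rewrite subr0 /=; lra.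
  case: leqP => h /=; last by have := hlo _ h; lra.
  by have /andP[_ h2] := x01 (s + k * M)%N; lra.
rewrite big_split /= sumr_const card_ord -[X in X + _]mulr_natl lerD2l.
rewrite -natr_sum ler_nat; apply: leq_trans (card_bad_shift M j a).
rewrite -/A -sum1_card [X in (_ <= X)%N]big_mkcond; apply: leq_sum => s _.
by case: (s \in A).
Qed.

End ShiftedGrid.

(** * Logarithmic grid size *)

Section Asymptotics.
Variable R : realType.

Definition gridsize (n : nat) : nat := (trunc_log 2 n).+1.

Lemma gridsize_lt n : (n < 2 ^ gridsize n)%N.
Proof. exact: trunc_log_ltn. Qed.

(** For q = M %/ 5 one has M <= 5 * 2 ^ q, because q < 2 ^ q; take fifth powers. *)
Lemma pow5_le M : (M ^ 5 <= 5 ^ 5 * 2 ^ M)%N.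
Proof.
have h : (M <= 5 * 2 ^ (M %/ 5))%N.
  have h1 := ltn_expl (M %/ 5) (isT : 1 < 2)%N.
  by have := divn_eq M 5; have := ltn_pmod M (isT : 0 < 5)%N; lia.
apply: (@leq_trans ((5 * 2 ^ (M %/ 5)) ^ 5)%N); first by rewrite leq_exp2r.
rewrite expnMn leq_mul2l -expnM leq_exp2l //.
by rewrite leq_divM.
Qed.

(** The exponent 5 is the 4 coming from the squared resolution M^-2 in Chebyshev's inequality, plus
    1 for a bound O(1/M). *)
Lemma gridsize_pow5 : exists2 a : R, 0 < a &
  forall n, (0 < n)%N -> (gridsize n)%:R ^+ 5 <= a * n%:R.
Proof.
exists (5 ^ 5 * 2)%:R => [|n n0]; first by rewrite ltr0n.
rewrite -natrX -natrM ler_nat; apply: (leq_trans (pow5_le _)).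
have := trunc_logP (isT : 1 < 2)%N n0; rewrite /gridsize (expnS 2) mulnA => h.
by rewrite leq_mul2l h orbT.
Qed.

Lemma gridsize_cvg : (gridsize n)%:R^-1 @[n --> \oo] --> (0 : R).
Proof.
apply/cvgrPdist_le => e e0; near=> n.
rewrite sub0r normrN ger0_norm ?invr_ge0 //.
rewrite invf_ple ?posrE // ?ltr0n //.
apply: (@le_trans _ _ (Num.truncn e^-1).+1%:R).
  by rewrite ltW // truncnS_gt.
rewrite ler_nat /gridsize ltnS; apply: trunc_log_max => //.
by near: n; exact: nbhs_infty_ge.
Unshelve. all: by end_near. Qed.

End Asymptotics.

(** * Transfer to matrices over [R[i]] *)

Section Bridge.
Local Open Scope complex_scope.
Local Open Scope sesquilinear_scope.
Variable R : realType.
Local Notation C := R[i].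

Definition kraus_chan (I : finType) m k (K : I -> 'M[C]_(k, m)) :
  {linear 'M[C]_m -> 'M[C]_k} := kraus K.

Lemma kraus_tpcp (I : finType) m k (K : I -> 'M[C]_(k, m)) :
  \sum_i (K i)^t* *m K i = 1%:M -> tpcp (kraus_chan K).
Proof.
move=> hK; split; first by move=> X; exact: (kraus_trace X hK).
by move=> r X hX; exact: (@ampl_kraus_posmx C I r m k K X hX).
Qed.

Lemma Rtr_complex k (A : 'M[C]_k) : 0 <= \tr A -> \tr A = (Rtr A)%:C.
Proof.
by rewrite /Rtr; case: (\tr A) => a b /=; rewrite lecE /= => /andP[/eqP -> _].
Qed.

End Bridge.

(** * Projectors of a nested family of subspaces *)

Section GridProjectors.
Local Open Scope sesquilinear_scope.
Variables (C : numClosedFieldType) (N : nat) (B : nat -> 'M[C]_N).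
Hypothesis B_nested : forall i j, (i <= j)%N -> (B i <= B j)%MS.

Definition grid_proj (j : nat) : 'M[C]_N := orthoproj (B j).
Local Notation P := grid_proj.

Lemma grid_proj_nested i j : (i <= j)%N -> P i *m P j = P i.
Proof. by move=> h; apply: orthoproj_nested; exact: B_nested. Qed.

Lemma grid_proj_nested' i j : (i <= j)%N -> P j *m P i = P i.
Proof.
move=> h; have [pi _] := orthoproj_proj (B i); have [pj _] := orthoproj_proj (B j).
by have := congr1 (fun A => A^t*) (grid_proj_nested h); rewrite /= adjmxM pi pj.
Qed.

Definition grid_cell (M s k : nat) : 'M[C]_N := cell P M s k.

Lemma grid_cell_proj M s k : is_proj (grid_cell M s k).
Proof.
rewrite /grid_cell /cell; case: k => [|k].
  by rewrite subr0; exact: orthoproj_proj.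
apply: proj_sub; [exact: orthoproj_proj|exact: orthoproj_proj|].
by apply: grid_proj_nested; rewrite leq_add2l leq_mul2r leqnSn orbT.
Qed.

Lemma grid_cell_proj_l M s k : P (s + k * M) *m grid_cell M s k = grid_cell M s k.
Proof.
have [_ h] := orthoproj_proj (B (s + k * M)); rewrite -/(P _) in h.
rewrite /grid_cell /cell; case: k h => [|k] h; first by rewrite subr0.
rewrite mulmxBr h grid_proj_nested' //.
by rewrite leq_add2l leq_mul2r leqnSn orbT.
Qed.

Lemma grid_cell_proj_r M s k : grid_cell M s k *m P (s + k * M) = grid_cell M s k.
Proof.
have [_ h] := orthoproj_proj (B (s + k * M)); rewrite -/(P _) in h.
rewrite /grid_cell /cell; case: k h => [|k] h; first by rewrite subr0.
rewrite mulmxBl h grid_proj_nested //.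
by rewrite leq_add2l leq_mul2r leqnSn orbT.
Qed.

Lemma grid_cell_trace M s k (rho : 'M[C]_N) :
  \tr (grid_cell M s k *m rho) = cell (fun j => \tr (P j *m rho)) M s k.
Proof.
rewrite /grid_cell /cell; case: k => [|k]; first by rewrite !subr0.
by rewrite mulmxBl linearB.
Qed.

Lemma grid_cell_sum M K :
  (0 < M)%N -> (forall j, (K * M <= j)%N -> P j = 1%:M) ->
  \sum_(w : 'I_M * 'I_K.+1) M%:R^-1 *: grid_cell M w.1 w.2 = 1%:M.
Proof.
move=> M0 hP.
rewrite -(pair_big xpredT xpredT
  (fun (s : 'I_M) (k : 'I_K.+1) => M%:R^-1 *: grid_cell M s k)) /=.
under eq_bigr do rewrite -scaler_sumr /grid_cell cell_sum hP ?leq_addl //.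
rewrite sumr_const card_ord -scaler_nat scalerA mulfV ?scale1r //.
by rewrite pnatr_eq0 -lt0n.
Qed.

End GridProjectors.

(** * Gentle measurement *)

Section Gentle.
Local Open Scope sesquilinear_scope.
Variables (C : numClosedFieldType) (N : nat).
Implicit Types rho Q : 'M[C]_N.

Lemma proj_trace_bounds rho Q : posmx rho -> \tr rho = 1 -> is_proj Q ->
  0 <= \tr (Q *m rho) <= 1.
Proof.
move=> hr tr1 pQ; rewrite posmx_mul_trace_ge0 //=; last exact: proj_posmx.
rewrite -subr_ge0 -[X in X - _]tr1 -{1}(mul1mx rho) -linearB -mulmxBl.
by apply: posmx_mul_trace_ge0 => //; apply/proj_posmx/proj_sub => //;
  [exact: is_proj1|rewrite mulmx1].
Qed.

Lemma sqrtmx_measure (c : C) rho Q : 0 <= c -> is_proj Q ->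
  sqrtmx (c *: Q) *m rho *m sqrtmx (c *: Q) = c *: (Q *m rho *m Q).
Proof.
move=> c0 pQ; rewrite sqrtmx_scale_proj // -!scalemxAl -scalemxAr scalerA.
by rewrite -expr2 sqrtCK.
Qed.

Lemma rescale_measured (m t : C) (X : 'M[C]_N) : m != 0 ->
  (m^-1 * t)^-1 *: (m^-1 *: X) = t^-1 *: X.
Proof. by move=> m0; rewrite scalerA invfM invrK mulrAC mulfV // mul1r. Qed.

Lemma measure_trace rho Q : is_proj Q -> \tr (Q *m rho *m Q) = \tr (Q *m rho).
Proof. by case=> _ q2; rewrite mxtrace_mulC mulmxA q2. Qed.

(* The fidelity is sqrt t >= t, where t = Tr Q rho. *)
Lemma gentle_fidelity rho Q : posmx rho -> \tr rho = 1 -> is_proj Q ->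
  \tr (Q *m rho) != 0 ->
  let A := sqrtmx rho *m sqrtmx ((\tr (Q *m rho))^-1 *: (Q *m rho *m Q)) in
  \tr (Q *m rho) <= \tr (sqrtmx (A^t* *m A)).
Proof.
move=> hr tr1 pQ t0; lazy zeta; set A := sqrtmx rho *m _.
have /andP[tge0 tle1] := proj_trace_bounds hr tr1 pQ.
have ti0 : 0 <= (\tr (Q *m rho))^-1 by rewrite invr_ge0.
have := fidelity_proj hr pQ ti0; rewrite -/A /= => ->.
move: (\tr (Q *m rho)) t0 tge0 tle1 ti0 {A} => t t0 tge0 tle1 ti0.
rewrite -[X in X <= _]mul1r; apply: ler_wpM2r => //.
rewrite -[X in X <= _]sqrtC1 ler_sqrtC ?nnegrE ?ler01 //.
by rewrite invr_ge1 ?unitfE // lt_def t0.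
Qed.

End Gentle.

(** * The code of a nested family of subspaces *)

Section GridCode.
Local Open Scope complex_scope.
Local Open Scope sesquilinear_scope.
Variables (R : realType) (N : nat).
Local Notation C := R[i].

Lemma ReZ (a : R) (z : C) : complex.Re (a%:C * z) = a * complex.Re z.
Proof. by case: z => x y /=; rewrite mul0r subr0. Qed.

Lemma le_Re (z w : C) : z <= w -> complex.Re z <= complex.Re w.
Proof. by rewrite lecE => /andP[]. Qed.

Lemma ReB (z w : C) : complex.Re (z - w) = complex.Re z - complex.Re w.
Proof. by case: z => a b; case: w. Qed.

Lemma ReD (z w : C) : complex.Re (z + w) = complex.Re z + complex.Re w.
Proof. by case: z => a b; case: w. Qed.

Lemma Re_sum (I : Type) (r : seq I) (Q : pred I) (F : I -> C) :
  complex.Re (\sum_(i <- r | Q i) F i) = \sum_(i <- r | Q i) complex.Re (F i).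
Proof. by apply: (big_morph (@complex.Re R)) => //; exact: ReD. Qed.

Lemma natVC (m : nat) : (m%:R^-1 : C) = (m%:R^-1)%:C.
Proof. by rewrite fmorphV rmorph_nat. Qed.

Definition weight (A rho : 'M[C]_N) : R := complex.Re (\tr (A *m rho)).

Lemma weight_proj_bounds (rho Q : 'M[C]_N) : posmx rho -> \tr rho = 1 ->
  is_proj Q -> 0 <= weight Q rho <= 1.
Proof.
move=> hr tr1 pQ; have /andP[h0 h1] := proj_trace_bounds hr tr1 pQ.
by apply/andP; split; [exact: (le_Re h0)|exact: (le_Re h1)].
Qed.

Variables (B : nat -> 'M[C]_N) (M K : nat).
Hypothesis B_nested : forall i j, (i <= j)%N -> (B i <= B j)%MS.
Hypothesis B_rank : forall j, (0 < \rank (B j))%N.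
Hypothesis B_full : forall j, (K * M <= j)%N -> grid_proj B j = 1%:M.
Hypothesis M0 : (0 < M)%N.

Definition grid_data : finType := ('I_M * 'I_K.+1)%type.

Definition level (w : grid_data) : nat := (w.1 + w.2 * M)%N.

Definition grid_povm (w : grid_data) : 'M[C]_N :=
  M%:R^-1 *: grid_cell B M w.1 w.2.

Lemma invM_ge0 : 0 <= M%:R^-1 :> C.
Proof. by rewrite invr_ge0 ler0n. Qed.

Lemma grid_povm_psd w : psd (grid_povm w).
Proof.
exact: (posmxZ invM_ge0 (proj_posmx (grid_cell_proj B_nested M w.1 w.2))).
Qed.

Lemma grid_povm_sum : \sum_w grid_povm w = 1%:M.
Proof. exact: (grid_cell_sum M0 B_full). Qed.

Definition grid_dim (w : grid_data) : nat := \rank (B (level w)).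

Definition grid_enc_kraus (w : grid_data) : option 'I_N -> 'M[C]_(grid_dim w, N) :=
  enc_kraus (Ordinal (B_rank (level w))) (onbasis (B (level w))).

Definition grid_dec_kraus (w : grid_data) : unit -> 'M[C]_(N, grid_dim w) :=
  fun=> (onbasis (B (level w)))^t*.

Lemma grid_enc_sum w :
  \sum_i (grid_enc_kraus w i)^t* *m grid_enc_kraus w i = 1%:M.
Proof. exact: (enc_kraus_sum _ (onbasis_unitary _)). Qed.

Lemma grid_dec_sum w :
  \sum_i (grid_dec_kraus w i)^t* *m grid_dec_kraus w i = 1%:M.
Proof. exact: (dec_kraus_sum (onbasis_unitary _)). Qed.

Definition grid_code : vlcode R N :=
  @VLCode R N grid_data grid_povm grid_povm_psd grid_povm_sum grid_dim
    (fun w => kraus_chan (grid_enc_kraus w))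
    (fun w => kraus_tpcp (grid_enc_sum w))
    (fun w => kraus_chan (grid_dec_kraus w))
    (fun w => kraus_tpcp (grid_dec_sum w)).

Local Notation Q w := (grid_cell B M w.1 w.2).

Lemma grid_encode (w : grid_data) (rho : 'M[C]_N) :
  encode (c := grid_code) w rho
  = kraus (grid_enc_kraus w) (M%:R^-1 *: (Q w *m rho *m Q w)).
Proof.
exact: (congr1 (kraus _)
  (sqrtmx_measure rho invM_ge0 (grid_cell_proj B_nested M w.1 w.2))).
Qed.

Lemma grid_encode_trace (w : grid_data) (rho : 'M[C]_N) :
  \tr (encode (c := grid_code) w rho) = M%:R^-1 * \tr (Q w *m rho).
Proof.
rewrite grid_encode; apply: (etrans (kraus_trace _ (grid_enc_sum w))).
apply: (etrans (mxtraceZ _ _)); congr (_ * _).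
exact: (measure_trace _ (grid_cell_proj B_nested M w.1 w.2)).
Qed.

Lemma grid_encode_Rtr (w : grid_data) (rho : 'M[C]_N) :
  Rtr (encode (c := grid_code) w rho) = M%:R^-1 * weight (Q w) rho.
Proof. by rewrite /Rtr grid_encode_trace natVC ReZ. Qed.

(** The cell lies inside the subspace of its upper end, so compression loses nothing and the decoder
    returns the post-measurement state; the shift probability 1/M cancels in the normalisation. *)
Lemma grid_decode (w : grid_data) (rho : 'M[C]_N) :
  let s := encode (c := grid_code) w rho in
  dec_chan (v := grid_code) w ((\tr s)^-1 *: s)
  = (\tr (Q w *m rho))^-1 *: (Q w *m rho *m Q w).
Proof.
lazy zeta; rewrite linearZ grid_encode_trace grid_encode.
set X := M%:R^-1 *: (Q w *m rho *m Q w).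
have -> : dec_chan (v := grid_code) w (kraus (grid_enc_kraus w) X) = X.
  apply: (enc_dec_kraus (Ordinal (B_rank (level w)))).
    rewrite -/(orthoproj (B (level w))) -/(grid_proj B (level w)) /X.
    by rewrite -scalemxAr !mulmxA grid_cell_proj_l.
  rewrite -/(orthoproj (B (level w))) -/(grid_proj B (level w)) /X.
  by rewrite -scalemxAl -!mulmxA grid_cell_proj_r.
by apply: rescale_measured; rewrite pnatr_eq0 -lt0n.
Qed.

Lemma grid_error (w : grid_data) (rho : 'M[C]_N) : density rho ->
  let s := encode (c := grid_code) w rho in
  0 <= Rtr s * bures rho (dec_chan (v := grid_code) w ((\tr s)^-1 *: s)) ^+ 2
    <= M%:R^-1 * (weight (Q w) rho * (1 - weight (Q w) rho)).
Proof.
move=> [hr tr1]; lazy zeta; rewrite grid_decode grid_encode_Rtr.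
have pQ := grid_cell_proj B_nested M w.1 w.2.
have /andP[x0 x1] := weight_proj_bounds hr tr1 pQ.
have m0 : 0 <= M%:R^-1 :> R by rewrite invr_ge0 ler0n.
rewrite mulr_ge0 ?sqr_ge0 ?mulr_ge0 //= -mulrA; apply: ler_wpM2l => //.
have [t0|t0] := eqVneq (\tr (Q w *m rho)) 0; first by rewrite /weight t0 !mul0r.
apply: ler_wpM2l => //; rewrite /bures.
set F := Rtr _; have hF : weight (Q w) rho <= F.
  by apply: le_Re; exact: (gentle_fidelity hr tr1 pQ t0).
(* If F > 1, [Num.sqrt] of the negative number 1 - F is 0, and the bound holds since the weight is
   at most 1. *)
have [hle|hlt] := leP 0 (1 - F).
  by rewrite sqr_sqrtr // lerB.
by rewrite ler0_sqrtr ?expr0n ?subr_ge0 // ltW.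
Qed.

End GridCode.

(** * The average state of a source *)

Section RealSums.
Variables (R : realType) (T : choiceType) (S : set T).
Implicit Types f g u v : T -> R.

Definition nnsum f : R := fine (\esum_(x in S) (f x)%:E).

Definition abs_summable f : Prop := (\esum_(x in S) `|f x|%:E < +oo)%E.

Definition nonneg_on f : Prop := forall x, S x -> 0 <= f x.

Lemma abs_summable_le f g :
  (forall x, S x -> `|f x| <= `|g x|) -> abs_summable g -> abs_summable f.
Proof.
by move=> h; apply: le_lt_trans; apply: le_esum => x Sx; rewrite lee_fin h.
Qed.

Lemma nnsumE f : nonneg_on f -> abs_summable f ->
  \esum_(x in S) (f x)%:E = (nnsum f)%:E.
Proof.
move=> f0 sf; rewrite fineK // ge0_fin_numE.
  apply: le_lt_trans sf; apply: le_esum => x Sx.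
  by rewrite lee_fin ler_norm.
by apply: esum_ge0 => x Sx; rewrite lee_fin f0.
Qed.

Lemma abs_summableD f g :
  abs_summable f -> abs_summable g -> abs_summable (fun x => f x + g x).
Proof.
move=> sf sg; apply: le_lt_trans (lte_add_pinfty sf sg).
rewrite -esumD => [|x Sx|x Sx]; rewrite ?lee_fin ?normr_ge0 //.
by apply: le_esum => x Sx; rewrite -EFinD lee_fin ler_normD.
Qed.

Lemma nnsumD f g : nonneg_on f -> nonneg_on g -> abs_summable f ->
  abs_summable g -> nnsum (fun x => f x + g x) = nnsum f + nnsum g.
Proof.
move=> f0 g0 sf sg; apply: EFin_inj; rewrite EFinD -!nnsumE //.
- by rewrite -esumD // => x Sx; rewrite lee_fin ?f0 ?g0.
- by move=> x Sx; rewrite addr_ge0 ?f0 ?g0.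
- exact: abs_summableD.
Qed.

Lemma eq_nnsum f g : (forall x, S x -> f x = g x) -> nnsum f = nnsum g.
Proof. by move=> h; congr fine; apply: eq_esum => x Sx; rewrite h. Qed.

(** One inequality, applied to a and then to its inverse, gives both directions. *)
Lemma esumZ (a : R) f : 0 <= a -> nonneg_on f ->
  \esum_(x in S) (a * f x)%:E = (a%:E * \esum_(x in S) (f x)%:E)%E.
Proof.
have key (b : R) g : 0 < b -> nonneg_on g ->
    (\esum_(x in S) (b * g x)%:E <= b%:E * \esum_(x in S) (g x)%:E)%E.
  move=> b0 g0; apply: ge_ereal_sup => _ [X [finX XS] <-].
  rewrite fsbig_finite //= sumEFin -mulr_sumr EFinM -sumEFin.
  rewrite lee_pmul2l //; apply: ereal_sup_ubound.
  by exists X => //; rewrite fsbig_finite.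
rewrite le_eqVlt => /predU1P[<-|a0] f0.
  by rewrite mul0e esum1 // => x _; rewrite mul0r.
apply/eqP; rewrite eq_le key //= -(@lee_pmul2l _ a^-1%:E) ?lte_fin ?invr_gt0 //.
rewrite muleA -EFinM mulVf ?gt_eqF // mul1e.
apply: le_trans (key _ _ _ _); rewrite ?invr_gt0 //.
  by apply: le_esum => x _; rewrite mulrA mulVf ?gt_eqF // mul1r.
by move=> x Sx; rewrite mulr_ge0 ?f0 // ltW.
Qed.

Lemma abs_summableZ (a : R) f : abs_summable f -> abs_summable (fun x => a * f x).
Proof.
move=> sf; rewrite /abs_summable.
under eq_esum do rewrite normrM.
rewrite (esumZ (normr_ge0 a)); last by move=> x _; exact: normr_ge0.
rewrite (@nnsumE (fun x => `|f x|)); first by rewrite -EFinM ltry.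
  by move=> x _; exact: normr_ge0.
by apply: abs_summable_le sf => x _; rewrite normr_id.
Qed.

Lemma nnsumZ (a : R) f : 0 <= a -> nonneg_on f -> abs_summable f ->
  nnsum (fun x => a * f x) = a * nnsum f.
Proof. by move=> a0 f0 sf; rewrite /nnsum esumZ // nnsumE // -EFinM. Qed.

(** Positive parts are not additive, so linearity is checked on convenient decompositions u - v
    instead: adding v to the positive part of f, or u to its negative part, gives the same
    function. *)
Lemma rsum_sub f u v : nonneg_on u -> nonneg_on v -> abs_summable u ->
  abs_summable v -> (forall x, S x -> f x = u x - v x) ->
  rsum S f = nnsum u - nnsum v.
Proof.
move=> u0 v0 su sv fE; pose fp x := Num.max (f x) 0; pose fn x := Num.max (- f x) 0.
have fp0 : nonneg_on fp by move=> x _; rewrite le_max lexx orbT.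
have fn0 : nonneg_on fn by move=> x _; rewrite le_max lexx orbT.
have sfp : abs_summable fp.
  apply: abs_summable_le su => x Sx; rewrite !ger0_norm ?fp0 ?u0 //.
  by rewrite ge_max u0 // andbT fE // lerBlDr lerDl v0.
have sfn : abs_summable fn.
  apply: abs_summable_le sv => x Sx; rewrite !ger0_norm ?fn0 ?v0 //.
  by rewrite ge_max v0 // andbT fE // opprB lerBlDr lerDl u0.
have : nnsum fp + nnsum v = nnsum fn + nnsum u.
  rewrite -!nnsumD //; apply: eq_nnsum => x Sx; rewrite /fp /fn.
  have := fE x Sx; have [h|h] := leP (f x) 0.
    by rewrite max_l ?oppr_ge0 // => e; lra.
  by rewrite max_r ?oppr_le0 1?ltW // => e; lra.
by rewrite -[rsum S f]/(nnsum fp - nnsum fn) => h; lra.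
Qed.

Let posp f x := Num.max (f x) 0.
Let negp f x := Num.max (- f x) 0.

Let decomp f x : f x = posp f x - negp f x.
Proof.
rewrite /posp /negp; have [h|h] := leP (f x) 0.
  by rewrite max_l ?oppr_ge0 // sub0r opprK.
by rewrite max_r ?subr0 // oppr_le0 ltW.
Qed.

Let posp0 f : nonneg_on (posp f).
Proof. by move=> x _; rewrite le_max lexx orbT. Qed.

Let negp0 f : nonneg_on (negp f).
Proof. by move=> x _; rewrite le_max lexx orbT. Qed.

Let sposp f : abs_summable f -> abs_summable (posp f).
Proof.
apply: abs_summable_le => x Sx; rewrite (ger0_norm (posp0 _ Sx)).
by rewrite ge_max ler_norm normr_ge0.
Qed.

Let snegp f : abs_summable f -> abs_summable (negp f).
Proof.
apply: abs_summable_le => x Sx; rewrite (ger0_norm (negp0 _ Sx)).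
by rewrite ge_max normr_ge0 -normrN ler_norm.
Qed.

Lemma rsumE f : rsum S f = nnsum (posp f) - nnsum (negp f).
Proof. by []. Qed.

Lemma eq_rsum f g : (forall x, S x -> f x = g x) -> rsum S f = rsum S g.
Proof.
move=> h; rewrite !rsumE.
by congr (_ - _); apply: eq_nnsum => x Sx; rewrite /posp /negp h.
Qed.

Lemma rsumD f g : abs_summable f -> abs_summable g ->
  rsum S (fun x => f x + g x) = rsum S f + rsum S g.
Proof.
move=> sf sg; rewrite (rsum_sub (u := fun x => posp f x + posp g x)
  (v := fun x => negp f x + negp g x)).
- rewrite !nnsumD ?rsumE; first lra; solve [exact: posp0|exact: negp0|
    exact: sposp|exact: snegp].
- by move=> x Sx; rewrite addr_ge0 ?posp0.
- by move=> x Sx; rewrite addr_ge0 ?negp0.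
- by apply: abs_summableD; exact: sposp.
- by apply: abs_summableD; exact: snegp.
- by move=> x _; rewrite {1}(decomp f) {1}(decomp g); lra.
Qed.

Lemma rsumZ (a : R) f : abs_summable f ->
  rsum S (fun x => a * f x) = a * rsum S f.
Proof.
move=> sf; have [a0|a0] := leP 0 a.
  rewrite (rsum_sub (u := fun x => a * posp f x) (v := fun x => a * negp f x)).
  - rewrite !nnsumZ ?rsumE //; first lra; solve [exact: posp0|exact: negp0|
      exact: sposp|exact: snegp].
  - by move=> x Sx; rewrite mulr_ge0 ?posp0.
  - by move=> x Sx; rewrite mulr_ge0 ?negp0.
  - by apply: abs_summableZ; exact: sposp.
  - by apply: abs_summableZ; exact: snegp.
  - by move=> x _; rewrite {1}(decomp f) mulrBr.
have a0' : 0 <= - a by rewrite oppr_ge0 ltW.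
rewrite (rsum_sub (u := fun x => - a * negp f x) (v := fun x => - a * posp f x)).
- rewrite !nnsumZ ?rsumE //; first lra; solve [exact: posp0|exact: negp0|
    exact: sposp|exact: snegp].
- by move=> x Sx; rewrite mulr_ge0 ?negp0.
- by move=> x Sx; rewrite mulr_ge0 ?posp0.
- by apply: abs_summableZ; exact: snegp.
- by apply: abs_summableZ; exact: sposp.
- by move=> x _; rewrite {1}(decomp f); lra.
Qed.

Lemma rsum0 : rsum S (fun=> 0 : R) = 0.
Proof. by rewrite rsumE /posp /negp oppr0 subrr. Qed.

Lemma abs_summable0 : abs_summable (fun=> 0 : R).
Proof. by rewrite /abs_summable esum1 // => x _; rewrite normr0. Qed.

Lemma rsum_lin (I : Type) (r : seq I) (a : I -> R) (F : I -> T -> R) :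
  (forall i, abs_summable (F i)) ->
  abs_summable (fun x => \sum_(i <- r) a i * F i x) /\
  rsum S (fun x => \sum_(i <- r) a i * F i x) = \sum_(i <- r) a i * rsum S (F i).
Proof.
move=> sF; elim: r => [|i r [IH1 IH2]].
  under eq_fun do rewrite big_nil.
  by rewrite big_nil; split; [exact: abs_summable0|exact: rsum0].
under eq_fun do rewrite big_cons.
split; first by apply: abs_summableD => //; exact: abs_summableZ.
by rewrite big_cons rsumD // ?IH2 ?rsumZ //; exact: abs_summableZ.
Qed.

Lemma rsum_ge (f : T -> R) (s : seq T) : nonneg_on f -> abs_summable f ->
  uniq s -> (forall x, x \in s -> S x) -> \sum_(x <- s) f x <= rsum S f.
Proof.
move=> f0 sf us sS.
have -> : rsum S f = nnsum f.
  have z0 : nonneg_on (fun=> 0 : R) by move=> x _.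
  rewrite (rsum_sub f0 z0 sf abs_summable0 (fun x _ => esym (subr0 (f x)))).
  by rewrite [X in _ - X](_ : _ = 0) ?subr0 // /nnsum esum1.
rewrite -lee_fin -nnsumE // -sumEFin fsbig_seq //.
by apply: ereal_sup_ubound; exists [set` s].
Qed.

End RealSums.

Section EntryBound.
Local Open Scope sesquilinear_scope.
Variables (C : numClosedFieldType) (d : nat).

Lemma quad_two (A : 'M[C]_d) i j (c : C) :
  let x : 'cV[C]_d := delta_mx i 0 + c *: delta_mx j 0 in
  (x^t* *m A *m x) 0 0 = A i i + c^* * A j i + (c * A i j + c * c^* * A j j).
Proof.
have eD (M N : 'M[C]_1) : (M + N) 0 0 = M 0 0 + N 0 0 by rewrite mxE.
have eZ a (M : 'M[C]_1) : (a *: M) 0 0 = a * M 0 0 by rewrite mxE.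
rewrite /= adjmxD adjmxZ !mulmxDl !mulmxDr -!scalemxAl -!scalemxAr.
by rewrite !eD !eZ !quad_delta; ring.
Qed.

(** Test positivity on e_i + c e_j with the phase c for which c A_ij = -|A_ij|: this gives 2 |A_ij|
    <= A_ii + A_jj <= 2. *)
Lemma posmx_entry_le1 (A : 'M[C]_d) i j : posmx A -> \tr A = 1 -> `|A i j| <= 1.
Proof.
move=> hA tr1; have d0 k : 0 <= A k k by rewrite -quad_delta.
have d1 k : A k k <= 1.
  by rewrite -tr1 /mxtrace (bigD1 k) //= lerDl sumr_ge0.
have [->|a0] := eqVneq (A i j) 0; first by rewrite normr0 ler01.
have n0 : `|A i j| != 0 by rewrite normr_eq0.
pose c := - (A i j)^* / `|A i j|.
have cA : c * A i j = - `|A i j|.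
  by rewrite /c mulrAC mulNr -normCKC expr2 mulNr mulfK.
have Aji : A j i = (A i j)^* by have /matrixP/(_ j i) := esym (posmx_herm hA); rewrite !mxE.
have cA' : c^* * A j i = - `|A i j|.
  rewrite Aji -rmorphM cA rmorphN /=; congr (- _).
  by rewrite conj_Creal // normr_real.
have cc : c * c^* = 1.
  rewrite -normCK /c normrM normrN norm_conjC normfV normr_id mulfV //.
  by rewrite expr1n.
have := hA (delta_mx i 0 + c *: delta_mx j 0).
rewrite quad_two cA cA' cc mul1r => h.
have h2 : `|A i j| *+ 2 <= 1 *+ 2.
  apply: (@le_trans _ _ (A i i + A j j)); last by rewrite [X in _ <= X]mulr2n lerD.
  by rewrite -subr_ge0; move: h; congr (0 <= _); rewrite mulr2n; ring.
by rewrite lerMn2r in h2.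
Qed.

End EntryBound.

Section Average.
Local Open Scope complex_scope.
Local Open Scope sesquilinear_scope.
Variables (R : realType) (d : nat) (p : source R d).
Local Notation C := R[i].
Local Notation D := (@density R d).

Lemma density_entry (rho : 'M[C]_d) i j : D rho ->
  `|complex.Re (rho i j)| <= 1 /\ `|complex.Im (rho i j)| <= 1.
Proof.
move=> [h1 h2]; have h : `|rho i j| <= 1 := posmx_entry_le1 i j h1 h2.
split; rewrite -lecR; apply: le_trans h; first exact: normc_ge_Re.
case: (rho i j) => a b; rewrite normc_def /= lecR -sqrtr_sqr ler_wsqrtr //.
by rewrite lerDr sqr_ge0.
Qed.

Lemma source_summable (f : 'M[C]_d -> R) : (forall rho, D rho -> `|f rho| <= 1) ->
  abs_summable D (fun rho => p rho * f rho).
Proof.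
move=> hf; apply: (@abs_summable_le _ _ _ _ p).
  move=> rho hr; rewrite normrM -[X in _ <= X]mulr1.
  by apply: ler_wpM2l => //; exact: hf.
rewrite /abs_summable (eq_esum (b := fun rho => (p rho)%:E)).
  by rewrite mass_sum ltry.
by move=> rho _; rewrite ger0_norm // mass_ge0.
Qed.

Lemma Re_trace_mul (G A : 'M[C]_d) : complex.Re (\tr (G *m A)) =
  \sum_(q : 'I_d * 'I_d) complex.Re (G q.1 q.2) * complex.Re (A q.2 q.1)
  + \sum_(q : 'I_d * 'I_d) - complex.Im (G q.1 q.2) * complex.Im (A q.2 q.1).
Proof.
rewrite -big_split /=.
rewrite -(pair_big xpredT xpredT (fun i j : 'I_d =>
  complex.Re (G i j) * complex.Re (A j i) + - complex.Im (G i j) * complex.Im (A j i))) /=.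
rewrite /mxtrace Re_sum; apply: eq_bigr => i _.
rewrite mxE Re_sum; apply: eq_bigr => j _.
by case: (G i j) => a b; case: (A j i) => a' b' /=; rewrite mulNr.
Qed.

(** This moves a trace through the infinite sum in [average]. G is arbitrary, not only positive, so
    that multiplying it by -i reaches the imaginary parts as well. *)
Lemma average_Re_trace (G : 'M[C]_d) :
  complex.Re (\tr (G *m average p))
  = rsum D (fun rho => p rho * complex.Re (\tr (G *m rho))).
Proof.
rewrite Re_trace_mul.
pose F1 (q : 'I_d * 'I_d) (rho : 'M[C]_d) := p rho * complex.Re (rho q.2 q.1).
pose F2 (q : 'I_d * 'I_d) (rho : 'M[C]_d) := p rho * complex.Im (rho q.2 q.1).
have s1 q : abs_summable D (F1 q).
  by apply: source_summable => rho hr; exact: (density_entry _ _ hr).1.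
have s2 q : abs_summable D (F2 q).
  by apply: source_summable => rho hr; exact: (density_entry _ _ hr).2.
have [u1 e1] := rsum_lin (index_enum ('I_d * 'I_d)%type)
  (fun q => complex.Re (G q.1 q.2)) s1.
have [u2 e2] := rsum_lin (index_enum ('I_d * 'I_d)%type)
  (fun q => - complex.Im (G q.1 q.2)) s2.
transitivity (rsum D (fun rho =>
  \sum_(q : 'I_d * 'I_d) complex.Re (G q.1 q.2) * F1 q rho
  + \sum_(q : 'I_d * 'I_d) - complex.Im (G q.1 q.2) * F2 q rho)).
  rewrite rsumD // e1 e2; congr (_ + _); apply: eq_bigr => q _; congr (_ * _).
    by rewrite mxE.
  by rewrite mxE.
apply: eq_rsum => rho _; rewrite Re_trace_mul mulrDr !mulr_sumr.
by congr (_ + _); apply: eq_bigr => q _; rewrite mulrCA.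
Qed.

End Average.

Section AverageState.
Local Open Scope complex_scope.
Local Open Scope sesquilinear_scope.
Variables (R : realType) (d : nat) (p : source R d).
Local Notation C := R[i].
Local Notation D := (@density R d).

Lemma Re_trace_sum N (I : Type) (r : seq I) (a : I -> R) (G : 'M[C]_N)
    (F : I -> 'M[C]_N) :
  complex.Re (\tr (G *m \sum_(i <- r) (a i)%:C *: F i))
  = \sum_(i <- r) a i * complex.Re (\tr (G *m F i)).
Proof.
elim: r => [|i r IH]; first by rewrite !big_nil mulmx0 mxtrace0.
by rewrite !big_cons mulmxDr mxtraceD -scalemxAr mxtraceZ ReD ReZ IH.
Qed.

Lemma density_trace_ge0 (G rho : 'M[C]_d) : posmx G -> D rho ->
  0 <= \tr (G *m rho).
Proof. by move=> hG [hr _]; exact: posmx_mul_trace_ge0. Qed.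

Lemma posmx_trace_le (G rho : 'M[C]_d) : posmx G -> D rho ->
  0 <= complex.Re (\tr (G *m rho)) <= complex.Re (\sum_i \sum_j `|G i j|).
Proof.
move=> hG hr; have h0 := density_trace_ge0 hG hr.
apply/andP; split; first exact: (le_Re h0).
apply: le_Re; apply: le_trans (real_ler_norm (ger0_real h0)) _.
rewrite /mxtrace; apply: le_trans (ler_norm_sum _ _ _) _.
apply: ler_sum => i _; rewrite mxE; apply: le_trans (ler_norm_sum _ _ _) _.
apply: ler_sum => j _; rewrite normrM -[X in _ <= X]mulr1.
apply: ler_wpM2l; first exact: normr_ge0.
by case: hr => h1 h2; exact: posmx_entry_le1.
Qed.

Lemma source_trace_summable (G : 'M[C]_d) : posmx G ->
  abs_summable D (fun rho => p rho * complex.Re (\tr (G *m rho))).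
Proof.
move=> hG; set b := complex.Re (\sum_i \sum_j `|G i j|).
apply: (@abs_summable_le _ _ _ _ (fun rho => b * (p rho * 1))).
  move=> rho hr; have /andP[h0 h1] := posmx_trace_le hG hr.
  have p0 := mass_ge0 p rho.
  rewrite mulr1 mulrC !ger0_norm ?mulr_ge0 //; first exact: ler_wpM2r.
  exact: le_trans h0 h1.
by apply: abs_summableZ; apply: source_summable => rho _; rewrite normr1.
Qed.

Lemma ImE (z : C) : complex.Im z = complex.Re (Complex 0 (-1) * z).
Proof. by case: z => a b /=; rewrite mul0r sub0r mulN1r opprK. Qed.

Lemma average_Re_trace_ge (G : 'M[C]_d) (s : seq 'M[C]_d) : posmx G ->
  uniq s -> (forall rho, rho \in s -> D rho) ->
  \sum_(rho <- s) p rho * complex.Re (\tr (G *m rho))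
  <= complex.Re (\tr (G *m average p)).
Proof.
move=> hG us sD; rewrite average_Re_trace; apply: rsum_ge => //.
  move=> rho hr; rewrite mulr_ge0 ?mass_ge0 //.
  by have /andP[] := posmx_trace_le hG hr.
exact: source_trace_summable.
Qed.

Lemma average_trace_ge0 (G : 'M[C]_d) : posmx G -> 0 <= \tr (G *m average p).
Proof.
move=> hG; rewrite lecE; apply/andP; split.
  rewrite ImE -mxtraceZ scalemxAl average_Re_trace (@eq_rsum _ _ _ _ (fun=> 0)).
    by rewrite rsum0.
  move=> rho hr; rewrite -scalemxAl mxtraceZ -ImE.
  have := density_trace_ge0 hG hr; rewrite lecE => /andP[/eqP -> _].
  by rewrite mulr0.
have := @average_Re_trace_ge G [::] hG isT; rewrite big_nil; apply.
by move=> rho; rewrite in_nil.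
Qed.

Lemma average_trace1 : \tr (average p) = 1.
Proof.
have h0 := average_trace_ge0 (@posmx1 _ d); rewrite mul1mx in h0.
have := average_Re_trace p 1%:M; rewrite mul1mx => hRe.
rewrite (Rtr_complex h0) /Rtr hRe.
have -> : rsum D (fun rho => p rho * complex.Re (\tr (1%:M *m rho))) = 1; last by [].
rewrite (@eq_rsum _ _ _ _ p); last first.
  by move=> rho [_ tr1]; rewrite mul1mx tr1 mulr1.
rewrite (@rsum_sub _ _ _ _ p (fun=> 0)) //.
- by rewrite [X in _ - X](_ : _ = 0) ?subr0 // /nnsum ?mass_sum // esum1.
- by move=> rho _; exact: mass_ge0.
- rewrite /abs_summable (eq_esum (b := fun rho => (p rho)%:E)).
    by rewrite mass_sum ltry.
  by move=> rho _; rewrite ger0_norm // mass_ge0.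
- exact: abs_summable0.
- by move=> rho _; rewrite subr0.
Qed.

Lemma quad_trace (x : 'cV[C]_d) (A : 'M[C]_d) :
  (x^t* *m A *m x) 0 0 = \tr ((x *m x^t*) *m A).
Proof. by rewrite -[in RHS]mulmxA mxtrace_mulC /mxtrace big_ord1. Qed.

Lemma rank1_posmx (x : 'cV[C]_d) : posmx (x *m x^t*).
Proof. by have := posmx_gram (x^t*); rewrite trmxCK. Qed.

Lemma average_posmx : posmx (average p).
Proof.
by move=> x; rewrite quad_trace; apply: average_trace_ge0; exact: rank1_posmx.
Qed.

Lemma average_density : D (average p).
Proof. by split; [exact: average_posmx|exact: average_trace1]. Qed.

Definition partial_average (s : seq 'M[C]_d) : 'M[C]_d :=
  \sum_(rho <- s) (p rho)%:C *: rho.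

Lemma partial_average_posmx (s : seq 'M[C]_d) :
  (forall rho, rho \in s -> D rho) -> posmx (partial_average s).
Proof.
move=> sD; rewrite /partial_average big_seq; apply: posmx_sum => rho /sD[hr _].
by apply: posmxZ => //; rewrite lecR mass_ge0.
Qed.

Lemma average_sub_posmx (s : seq 'M[C]_d) :
  uniq s -> (forall rho, rho \in s -> D rho) ->
  posmx (average p - partial_average s).
Proof.
move=> us sD x; rewrite quad_trace mulmxBr linearB /= subr_ge0.
have hG := rank1_posmx x.
rewrite (Rtr_complex (average_trace_ge0 hG)).
rewrite (Rtr_complex (posmx_mul_trace_ge0 hG (partial_average_posmx sD))) lecR.
apply: le_trans (average_Re_trace_ge hG us sD); rewrite le_eqVlt; apply/orP; left.
by rewrite /Rtr /partial_average Re_trace_sum.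
Qed.

Variable n : nat.

(* By multilinearity, a sum over sequences drawn from finitely many states is
   the value at the n-th tensor power of their partial average, which the
   average dominates. *)
Lemma esum_states_le (G : 'M[C]_(pow_dim d n)) : posmx G ->
  (\esum_(rho in @states R d n) (iid p rho * weight G (tensor rho))%:E
   <= (weight G (tensor (fun _ : 'I_n => average p)))%:E)%E.
Proof.
move=> hG; apply: ge_ereal_sup => _ [X [finX XS] <-].
rewrite fsbig_finite //= sumEFin lee_fin.
set E := finmap.enum_fset _.
have ES rho : rho \in E -> @states R d n rho.
  by move=> h; apply: XS; move: h; rewrite /E in_fset_set // inE.
have uE : uniq E by exact: finmap.fset_uniq.
pose s := undup [seq (rho : {ffun 'I_n -> 'M[C]_d}) t | rho <- E, t <- enum 'I_n].
have us : uniq s by exact: undup_uniq.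
have sD rho : rho \in s -> D rho.
  by rewrite mem_undup => /allpairsP[[r t] /= [/ES hr _ ->]]; exact: hr.
have memE rho t : rho \in E -> rho t \in s.
  move=> hr; rewrite mem_undup; apply/allpairsP; exists (rho, t); split => //=.
  by rewrite mem_enum.
(* One index more than [size s]: [inord] needs a successor, and at the extra index [nth] returns 0,
   which is no density and so has mass 0. *)
pose I := 'I_(size s).+1; pose v (i : I) : 'M[C]_d := nth 0 s i.
have p_last : p 0 = 0.
  by apply: mass_out => -[_]; rewrite linear0 => /esym/eqP; rewrite oner_eq0.
have sum_v (V : zmodType) (F : 'M[C]_d -> V) : F 0 = 0 ->
    \sum_(i : I) F (v i) = \sum_(rho <- s) F rho.
  by move=> F0; rewrite big_ord_recr /= /v nth_default // F0 addr0 (big_nth 0) big_mkord.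
have h0 (rho : 'I_n -> 'M[C]_d) : (forall t, p (rho t) = 0 \/ D (rho t)) ->
    0 <= \prod_t p (rho t) * weight G (tensor rho).
  move=> hr; have [/existsP[t /eqP ht]|/existsPn hn] :=
    boolP [exists t, p (rho t) == 0].
    by rewrite (bigD1 t) //= ht !mul0r.
  apply: mulr_ge0; first by apply: prodr_ge0 => t _; exact: mass_ge0.
  apply: (@le_Re _ 0); apply: posmx_mul_trace_ge0 => //.
  apply: tens_posmx => t; case: (hr t) => [ht|[]//].
  by have := hn t; rewrite ht eqxx.
(* The sequences of E inject into index functions, so the sum over E is part of the sum over all
   index functions, whose other terms are nonnegative. *)
apply: (@le_trans _ _ (\sum_(f : {ffun 'I_n -> I})
    \prod_t p (v (f t)) * weight G (tensor (fun t => v (f t))))).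
  pose g (rho : {ffun 'I_n -> 'M[C]_d}) : {ffun 'I_n -> I} :=
    [ffun t => inord (index (rho t) s)].
  have vg rho : rho \in E -> forall t, v (g rho t) = rho t.
    move=> hr t; rewrite /v ffunE inordK ?nth_index ?memE //.
    by rewrite ltnS index_size.
  rewrite (eq_big_seq (fun rho => \prod_t p (v (g rho t)) *
      weight G (tensor (fun t => v (g rho t))))); last first.
    move=> rho hr; rewrite /iid; congr (_ * weight G _).
      by apply: eq_bigr => t _; rewrite vg.
    by apply: eq_tens => t; rewrite vg.
  rewrite -(big_map g xpredT (fun f => \prod_t p (v (f t)) *
      weight G (tensor (fun t => v (f t))))) /=.
  rewrite big_uniq /=; last first.
    rewrite map_inj_in_uniq // => r r' hr hr' e; apply/ffunP => t.
    by rewrite -(vg _ hr) -(vg _ hr') e.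
  rewrite big_mkcond /=; apply: ler_sum => f _; case: ifP => // _.
  apply: h0 => t; have [lt|ge] := ltnP (f t) (size s).
    by right; apply/sD/mem_nth.
  by left; rewrite /v nth_default.
have -> : \sum_(f : {ffun 'I_n -> I})
    \prod_t p (v (f t)) * weight G (tensor (fun t => v (f t)))
    = weight G (tens (fun _ : 'I_n => partial_average s)).
  have -> : tens (fun _ : 'I_n => partial_average s)
      = \sum_(f : {ffun 'I_n -> I}) (\prod_t (p (v (f t)))%:C) *:
          tens (fun t => v (f t)).
    rewrite /partial_average -(sum_v _ (fun rho => (p rho)%:C *: rho)) ?scaler0 //.
    rewrite (tens_sum (fun (_ : 'I_n) (i : I) => (p (v i))%:C *: v i)).
    by apply: eq_bigr => f _; rewrite tens_scale.
  under [X in weight G X]eq_bigr do rewrite -rmorph_prod.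
  by rewrite /weight Re_trace_sum.
rewrite -subr_ge0 /weight -ReB; apply: (@le_Re _ 0).
rewrite -linearB -mulmxBr; apply: posmx_mul_trace_ge0 => //.
by apply: tens_le; [exact: partial_average_posmx|exact: average_sub_posmx].
Qed.

End AverageState.

(** * Universal subspaces and rates *)

Section UniversalGrid.
Variables (R : realType) (d : nat).
Local Notation C := R[i].
Hypothesis d0 : (0 < d)%N.

Definition mesh (n : nat) : R := (gridsize n)%:R ^- 2.

Lemma mesh_gt0 n : 0 < mesh n.
Proof. by rewrite /mesh invr_gt0 exprn_gt0 // ltr0n. Qed.

Definition threshold (n j : nat) : nat := Num.truncn (expR (n%:R * (j%:R * mesh n))).

Lemma class_size_threshold n j (f : {ffun 'I_n -> 'I_d}) :
  (class_size f <= threshold n j)%N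
  = ((class_size f)%:R <= expR (n%:R * (j%:R * mesh n))).
Proof. by rewrite /threshold truncn_ge_nat // expR_ge0. Qed.

Lemma threshold_le n j : (threshold n j)%:R <= expR (n%:R * (j%:R * mesh n)).
Proof. by have /andP[] := truncn_itv (expR_ge0 (n%:R * (j%:R * mesh n))). Qed.

Lemma leq_threshold n i j : (i <= j)%N -> (threshold n i <= threshold n j)%N.
Proof.
move=> h; rewrite {2}/threshold truncn_ge_nat ?expR_ge0 //.
apply: le_trans (threshold_le n i) _; rewrite ler_expR; apply: ler_wpM2l => //.
by apply: ler_wpM2r; [exact/ltW/mesh_gt0|rewrite ler_nat].
Qed.

Definition grid_space (n j : nat) : 'M[C]_(pow_dim d n) :=
  univ_space C (fun f : {ffun 'I_n -> 'I_d} => class_size f <= threshold n j)%N.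

Lemma grid_space_nested n i j : (i <= j)%N -> (grid_space n i <= grid_space n j)%MS.
Proof.
move=> h; apply: univ_spaceS => f hf; apply: leq_trans hf _.
exact: leq_threshold.
Qed.

Lemma grid_space_rank n j :
  (\rank (grid_space n j) <= n.+1 ^ (d + d * d) * threshold n j)%N.
Proof.
apply: leq_trans (rank_univ_space _ _) _.
rewrite expnD mulnAC leq_mul2r; apply/orP; right.
by have := card_class_size_le 'I_d n (threshold n j); rewrite card_ord.
Qed.

Lemma threshold_gt0 n j : (0 < threshold n j)%N.
Proof.
rewrite /threshold truncn_gt0 -[X in X <= _]expR0 ler_expR.
by rewrite !mulr_ge0 //; exact/ltW/mesh_gt0.
Qed.

(** A constant sequence is alone in its type class, so even the lowest space contains its basis
    vector. Positive rank supplies the vector z of [enc_kraus]. *)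
Lemma grid_space_rank_gt0 n j : (0 < \rank (grid_space n j))%N.
Proof.
pose x : 'I_d := Ordinal d0; pose f : {ffun 'I_n -> 'I_d} := [ffun=> x].
have hf : (class_size f <= 1)%N.
  (* Under the point mass at x the sequence f has probability 1, so its class has at most one
     member. *)
  have := @class_size_prob R 'I_d n (fun y => (y == x)%:R) f.
  have -> : \prod_t (f t == x)%:R = 1 :> R by apply: big1 => t _; rewrite ffunE eqxx.
  rewrite mulr1 -(ler_nat R); apply; first by move=> y; rewrite ler0n.
  by rewrite (bigD1 x) // eqxx big1 /= ?addr0 // => y /negbTE ->.
rewrite lt0n mxrank_eq0; apply/negP => /eqP e.
have hJ : (class_size (basis_index (enum_rank f : 'I_(pow_dim d n)))
    <= threshold n j)%N.
  by rewrite basis_indexK; apply: leq_trans hf _; exact: threshold_gt0.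
have := @univ_space_row C d n
  (fun f : {ffun 'I_n -> 'I_d} => class_size f <= threshold n j)%N
  1%:M (enum_rank f) hJ.
rewrite -/(grid_space n j) e tens1 submx0 => /eqP/rowP/(_ (enum_rank f)).
by rewrite !mxE eqxx => /eqP; rewrite oner_eq0.
Qed.

(** With levels 1/M^2 apart and cells of M levels, the grid reaches the rate d + 2. The rate d makes
    the space full, as d^n <= e^{nd}, and bounds the entropy; the 2 leaves room for the rounding in
    [top_level]. *)
Definition grid_levels (n : nat) : nat := ((d + 2) * gridsize n)%N.

Lemma grid_space_full n j : (grid_levels n * gridsize n <= j)%N ->
  grid_proj (grid_space n) j = 1%:M.
Proof.
move=> hj; rewrite -[LHS]mul1mx; apply: orthoproj_id.
apply/row_subP => a; rewrite -tens1; apply: univ_space_row.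
rewrite class_size_threshold; apply: (@le_trans _ _ (d%:R ^+ n)).
  rewrite -natrX ler_nat; apply: leq_trans (max_card _) _.
  by rewrite card_ffun !card_ord.
have hd : d%:R <= expR (d%:R) :> R.
  by apply: le_trans (expR_ge1Dx _); rewrite lerDr.
apply: (@le_trans _ _ (expR (n%:R * d%:R))).
  by rewrite expRM_natl; apply: lerXn2r; rewrite ?nnegrE ?ler0n ?expR_ge0.
rewrite ler_expR; apply: ler_wpM2l => //.
rewrite /mesh ler_pdivlMr ?exprn_gt0 ?ltr0n // -natrX -natrM ler_nat.
apply: leq_trans hj; rewrite /grid_levels -mulnA mulnn.
by rewrite leq_mul2r leq_addr orbT.
Qed.

Section Estimates.
Variables (rho : 'M[C]_d) (n : nat).
Hypotheses (hrho : density rho) (n0 : (0 < n)%N).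

Definition spec (i : 'I_d) : R := complex.Re (spectral_diag rho 0 i).

Lemma specE i : spectral_diag rho 0 i = (spec i)%:C%C.
Proof.
have := (spectral_posmx hrho.1).2 i; rewrite /spec.
by case: (spectral_diag rho 0 i) => a b; rewrite lecE /= => /andP[/eqP -> _].
Qed.

Lemma spec_ge0 i : 0 <= spec i.
Proof. exact: (le_Re ((spectral_posmx hrho.1).2 i)). Qed.

Lemma spec_sum : \sum_i spec i = 1.
Proof.
rewrite /spec -Re_sum; have [hE _] := spectral_posmx hrho.1.
have -> : \sum_i spectral_diag rho 0 i = 1; last by [].
rewrite -[RHS]hrho.2 [in RHS]hE mxtrace_mulC mulmxA mulmxV ?spectral_unit //.
by rewrite mul1mx mxtrace_diag.
Qed.

Lemma entropyE : entropy rho = shannon spec.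
Proof.
rewrite /entropy /shannon; congr (- _); rewrite /Rtr.
rewrite (trace_mul_funmx (fun z : C => (ln (complex.Re z))%:C%C) hrho.1) Re_sum.
by apply: eq_bigr => i _; rewrite mulrC ReZ mulrC.
Qed.

Definition grid_mass (j : nat) : R :=
  weight (grid_proj (grid_space n) j) (tens (fun _ : 'I_n => rho)).

Let w j (f : {ffun 'I_n -> 'I_d}) : R :=
  complex.Re (spectral_weight rho (grid_proj (grid_space n) j) (enum_rank f)).

Lemma grid_massE j : grid_mass j
  = \sum_(f : {ffun 'I_n -> 'I_d}) (\prod_t spec (f t)) * w j f.
Proof.
rewrite /grid_mass /weight (trace_tens_spectral _ hrho.1) Re_sum.
rewrite -(sum_basis (fun f => (\prod_t spec (f t)) * w j f)).
apply: eq_bigr => a _; rewrite /w enum_valK -ReZ rmorph_prod; congr (complex.Re (_ * _)).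
by apply: eq_bigr => t _; rewrite specE.
Qed.

Let w01 j f : 0 <= w j f <= 1.
Proof.
have pP := orthoproj_proj (grid_space n j); apply/andP; split.
  exact: (le_Re (spectral_weight_ge0 rho pP (enum_rank f))).
exact: (le_Re (spectral_weight_le1 rho pP (enum_rank f))).
Qed.

Let w_sum j : \sum_f w j f = (\rank (grid_space n j))%:R.
Proof.
rewrite /w -(sum_basis (fun f => complex.Re (spectral_weight rho
  (grid_proj (grid_space n) j) (enum_rank f)))).
under eq_bigr do rewrite enum_valK.
rewrite -Re_sum spectral_weight_sum /grid_proj orthoproj_trace.
by rewrite -[in LHS](rmorph_nat (real_complex R)).
Qed.

Lemma grid_mass_upper j : shannon spec + mesh n <= j%:R * mesh n ->
  1 - ln_variance spec / (n%:R * mesh n ^+ 2) <= grid_mass j.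
Proof.
move=> hj; apply: le_trans (typical_prob spec_ge0 spec_sum n0 (mesh_gt0 n) hj) _.
rewrite grid_massE big_mkcond /=; apply: ler_sum => f _.
have p0 : 0 <= \prod_t spec (f t) by apply: prodr_ge0 => t _; exact: spec_ge0.
case: ifP => [h|_]; last by rewrite mulr_ge0 //; have /andP[] := w01 j f.
suff -> : w j f = 1 by rewrite mulr1.
rewrite /w spectral_weight1 //; apply: orthoproj_id; apply: univ_space_row.
rewrite basis_indexK class_size_threshold.
have := class_size_prob f spec_ge0 spec_sum => h1.
have h2 := le_trans (ler_wpM2l (ler0n R (class_size f)) h) h1.
by move: h2; rewrite expRN ler_pdivrMr ?expR_gt0 // mul1r.
Qed.

(** Of the three mesh widths, one is the Chebyshev deviation. The other two are the gap between the
    probability threshold e^{-n(H - mesh)} and the exponential part e^{n(H - 3 mesh)} of the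
    dimension, whence e^{-2n mesh}. *)
Lemma grid_mass_lower j : j%:R * mesh n <= shannon spec - 3 * mesh n ->
  grid_mass j <= ln_variance spec / (n%:R * mesh n ^+ 2)
    + (n.+1 ^ (d + d * d))%:R * expR (- (2 * (n%:R * mesh n))).
Proof.
move=> hj; rewrite grid_massE.
apply: le_trans (weighted_large_prob spec_ge0 spec_sum n0 (mesh_gt0 n) (w01 j)
  (lexx _)) _.
rewrite lerD2l w_sum.
apply: (@le_trans _ _ (expR (- (n%:R * (shannon spec - mesh n))) *
    ((n.+1 ^ (d + d * d))%:R * expR (n%:R * (j%:R * mesh n))))).
  apply: ler_wpM2l; first exact: expR_ge0.
  apply: (@le_trans _ _ (n.+1 ^ (d + d * d) * threshold n j)%:R).
    by rewrite ler_nat grid_space_rank.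
  by rewrite natrM; apply: ler_wpM2l; rewrite ?threshold_le.
rewrite mulrCA; apply: ler_wpM2l => //; rewrite -expRD ler_expR.
have : n%:R * (j%:R * mesh n) <= n%:R * (shannon spec - 3 * mesh n).
  by apply: ler_wpM2l.
rewrite !mulrBr; lra.
Qed.

End Estimates.

End UniversalGrid.

(** * Error and outcome probabilities averaged over the source *)

Section GridCodeAverages.
Local Open Scope complex_scope.
Local Open Scope sesquilinear_scope.
Variables (R : realType) (d n : nat).
Local Notation C := R[i].
Local Notation N := (pow_dim d n).
Variables (B : nat -> 'M[C]_N) (M K : nat).
Hypothesis B_nested : forall i j, (i <= j)%N -> (B i <= B j)%MS.
Hypothesis B_rank : forall j, (0 < \rank (B j))%N.
Hypothesis B_full : forall j, (K * M <= j)%N -> grid_proj B j = 1%:M.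
Hypothesis M0 : (0 < M)%N.
Variable k0 : 'I_M -> 'I_K.+1.

Let code := grid_code B_nested B_rank B_full M0.

Lemma weightZ (a : R) (G rho : 'M[C]_N) :
  weight (a%:C *: G) rho = a * weight G rho.
Proof. by rewrite /weight -scalemxAl mxtraceZ ReZ. Qed.

Lemma weight_sum (I : Type) (r : seq I) (F : I -> 'M[C]_N) (rho : 'M[C]_N) :
  weight (\sum_(i <- r) F i) rho = \sum_(i <- r) weight (F i) rho.
Proof.
elim: r => [|i r IH]; first by rewrite !big_nil /weight mul0mx mxtrace0.
by rewrite !big_cons -IH /weight mulmxDl mxtraceD ReD.
Qed.

Lemma weight_compl (G rho : 'M[C]_N) : \tr rho = 1 ->
  weight (1%:M - G) rho = 1 - weight G rho.
Proof. by move=> tr1; rewrite /weight mulmxBl linearB /= mul1mx tr1 ReB. Qed.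

(* The mass outside the cells chosen by k0, averaged over the shifts. *)
Definition miss_op : 'M[C]_N :=
  (M%:R^-1)%:C *: \sum_(s < M) (1%:M - grid_cell B M s (k0 s)).

Lemma miss_op_posmx : posmx miss_op.
Proof.
apply: posmxZ; first by rewrite lecR invr_ge0.
apply: posmx_sum => s _; apply/proj_posmx/proj_sub; first exact: is_proj1.
  exact: grid_cell_proj.
by rewrite mulmx1.
Qed.

Lemma weight_miss_op (rho : 'M[C]_N) : \tr rho = 1 ->
  weight miss_op rho
  = M%:R^-1 * \sum_(s < M) (1 - weight (grid_cell B M s (k0 s)) rho).
Proof.
move=> tr1; rewrite weightZ weight_sum; congr (_ * _).
by apply: eq_bigr => s _; rewrite weight_compl.
Qed.

Lemma weight_cells_sum (s : 'I_M) (rho : 'M[C]_N) : \tr rho = 1 ->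
  \sum_(k < K.+1) weight (grid_cell B M s k) rho = 1.
Proof.
move=> tr1; rewrite -weight_sum /grid_cell cell_sum B_full ?leq_addl //.
by rewrite /weight mul1mx tr1.
Qed.

Lemma weight_other_cells (s : 'I_M) (rho : 'M[C]_N) : \tr rho = 1 ->
  \sum_(k < K.+1 | k != k0 s) weight (grid_cell B M s k) rho
  = 1 - weight (grid_cell B M s (k0 s)) rho.
Proof.
move=> tr1; have := weight_cells_sum s tr1; rewrite (bigD1 (k0 s)) //= => h.
by rewrite -[X in X - _]h addrAC subrr add0r.
Qed.

Lemma sum_grid_data (P : pred (grid_data M K)) (F : nat -> nat -> R) :
  \sum_(w : grid_data M K | P w) F w.1 w.2
  = \sum_(s < M) \sum_(k < K.+1 | P (s, k)) F s k.
Proof.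
under [RHS]eq_bigr do rewrite big_mkcond.
by rewrite pair_big big_mkcond /=; apply: eq_bigr => -[s k].
Qed.

(** With x the mass of a cell, bound x (1 - x) by 1 - x for the chosen cell and by x for the others,
    whose masses add up to that same missed mass; hence the factor 2. The bound is linear in rho, as
    averaging over the source requires. *)
Lemma code_error_le (rho : 'M[C]_N) : density rho ->
  0 <= \sum_(w : data code)
      (let s := encode w rho in
       Rtr s * bures rho (dec_chan w ((\tr s)^-1 *: s)) ^+ 2)
    <= weight (2%:C *: miss_op) rho.
Proof.
move=> hr; have [hp tr1] := hr; apply/andP; split.
  apply: sumr_ge0 => w _.
  by have /andP[] := grid_error B_nested B_rank B_full M0 w hr.
apply: (@le_trans _ _ (\sum_(w : grid_data M K) M%:R^-1 *
    (weight (grid_cell B M w.1 w.2) rho * (1 - weight (grid_cell B M w.1 w.2) rho)))).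
  apply: ler_sum => w _.
  by have /andP[] := grid_error B_nested B_rank B_full M0 w hr.
rewrite -mulr_sumr weightZ weight_miss_op // mulrCA.
apply: ler_wpM2l; first by rewrite invr_ge0.
rewrite (sum_grid_data predT (fun s k => weight (grid_cell B M s k) rho *
  (1 - weight (grid_cell B M s k) rho))) mulr_sumr /=.
apply: ler_sum => s _; rewrite (bigD1 (k0 s)) //= mulr2n mulrDl mul1r.
have x01 k := weight_proj_bounds hp tr1 (grid_cell_proj B_nested M s k).
apply: lerD.
  have /andP[x0 x1] := x01 (k0 s).
  by rewrite -[X in _ <= X]mul1r ler_wpM2r // subr_ge0.
rewrite -(weight_other_cells s tr1); apply: ler_sum => k _.
have /andP[x0 x1] := x01 k.
by rewrite -[X in _ <= X]mulr1 ler_wpM2l // gerBl.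
Qed.

Variable p : source R d.

Lemma iid_ge0 (rho : {ffun 'I_n -> 'M[C]_d}) : 0 <= iid p rho.
Proof. by apply: prodr_ge0 => t _; exact: mass_ge0. Qed.

Lemma tensor_density (rho : 'I_n -> 'M[C]_d) :
  (forall t, density (rho t)) -> density (tensor rho).
Proof.
move=> h; split; first by apply: tens_posmx => t; have [] := h t.
have tr1 := tens_trace rho; rewrite big1 in tr1 => [//|t _].
by have [] := h t.
Qed.

Lemma avg_error_bounds :
  (0 <= avg_error p code
    <= (2 * weight miss_op (tens (fun _ : 'I_n => average p)))%:E)%E.
Proof.
apply/andP; split.
  apply: esum_ge0 => rho hr; rewrite lee_fin mulr_ge0 ?iid_ge0 //.
  by have /andP[] := code_error_le (tensor_density hr).
rewrite -weightZ; apply: le_trans (esum_states_le p _); last first.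
  by apply: posmxZ miss_op_posmx; rewrite lecR.
apply: le_esum => rho hr; rewrite lee_fin; apply: ler_wpM2l; first exact: iid_ge0.
by have /andP[] := code_error_le (tensor_density hr).
Qed.

Lemma outcome_prob_bounds (w : data code) :
  (0 <= outcome_prob p w <= (M%:R^-1 *
     weight (grid_cell B M w.1 w.2) (tens (fun _ : 'I_n => average p)))%:E)%E.
Proof.
have pQ := grid_cell_proj B_nested M w.1 w.2.
apply/andP; split.
  apply: esum_ge0 => rho hr; rewrite lee_fin mulr_ge0 ?iid_ge0 //.
  rewrite grid_encode_Rtr mulr_ge0 ?invr_ge0 //.
  have [h1 h2] := tensor_density hr.
  by have /andP[] := weight_proj_bounds h1 h2 pQ.
rewrite -weightZ; apply: le_trans (esum_states_le p _); last first.
  by apply: posmxZ (proj_posmx pQ); rewrite lecR invr_ge0.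
by apply: le_esum => rho hr; rewrite grid_encode_Rtr weightZ.
Qed.

Lemma event_prob_bounds (A : {set data code}) :
  (forall w : grid_data M K, w \in A -> w.2 != k0 w.1) ->
  (0 <= event_prob p A
    <= (weight miss_op (tens (fun _ : 'I_n => average p)))%:E)%E.
Proof.
move=> hA; have [hp tr1] : density (tens (fun _ : 'I_n => average p)).
  by apply: tensor_density => t; exact: average_density.
apply/andP; split.
  by apply: sume_ge0 => w _; have /andP[] := outcome_prob_bounds w.
apply: (@le_trans _ _ (\sum_(w in A) (M%:R^-1 *
     weight (grid_cell B M w.1 w.2) (tens (fun _ : 'I_n => average p)))%:E)%E).
  by apply: lee_sum => w _; have /andP[] := outcome_prob_bounds w.
rewrite sumEFin lee_fin -mulr_sumr weight_miss_op //.
apply: ler_wpM2l; first by rewrite invr_ge0.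
rewrite (sum_grid_data (fun w => w \in A) (fun s k => weight (grid_cell B M s k)
  (tens (fun _ : 'I_n => average p)))).
apply: ler_sum => s _; rewrite -(weight_other_cells s tr1).
rewrite big_mkcond [X in _ <= X]big_mkcond; apply: ler_sum => k _.
have /andP[x0 _] := weight_proj_bounds hp tr1 (grid_cell_proj B_nested M s k).
by case: ifP => [/hA /= ->|_] //; case: ifP.
Qed.

End GridCodeAverages.

(** * Convergence rates in terms of the grid size *)

Section Rates.
Variables (R : realType) (a : R).
Local Notation m n := ((gridsize n)%:R : R).
Hypothesis a0 : 0 < a.
Hypothesis pow5_bound : forall n, (0 < n)%N -> m n ^+ 5 <= a * n%:R.

Lemma gridsize_gt0 n : 0 < m n.
Proof. by rewrite ltr0n. Qed.

Lemma gridsize_ge1 n : 1 <= m n.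
Proof. by rewrite ler1n. Qed.

Lemma mesh_sqr_bound n : (0 < n)%N -> (n%:R * mesh R n ^+ 2)^-1 <= a / m n.
Proof.
move=> n0; have m0 := gridsize_gt0 n; have := pow5_bound n0.
have nR : 0 < n%:R :> R by rewrite ltr0n.
rewrite /mesh; move: (m n) m0 => x x0 h.
have -> : (n%:R * (x ^- 2) ^+ 2)^-1 = x ^+ 4 / n%:R by field; rewrite !gt_eqF.
rewrite ler_pdivrMr // mulrAC ler_pdivlMr //.
by rewrite -exprSr.
Qed.

Lemma mesh_bound n : (0 < n)%N -> m n ^+ 3 / a <= n%:R * mesh R n.
Proof.
move=> n0; have m0 := gridsize_gt0 n; have := pow5_bound n0.
rewrite /mesh; move: (m n) m0 => x x0 h.
rewrite ler_pdivrMr // mulrAC ler_pdivlMr ?exprn_gt0 //.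
by rewrite -exprD mulrC.
Qed.

Lemma succ_pow_bound n c : (n.+1 ^ c)%:R <= expR (m n * c%:R) :> R.
Proof.
apply: (@le_trans _ _ ((2 ^ gridsize n) ^ c)%:R).
  rewrite ler_nat; case: c => [|c]; first by rewrite !expn0.
  by rewrite leq_exp2r // gridsize_lt.
rewrite natrX expRM_natr; apply: lerXn2r; rewrite ?nnegrE ?expR_ge0 ?ler0n //.
rewrite natrX -[m n]mulr1 expRM_natl; apply: lerXn2r; rewrite ?nnegrE ?expR_ge0 //.
by have := @expR_ge1Dx R 1; rewrite (_ : 1 + 1 = 2%:R) // -natr1.
Qed.

(** Since c M <= n mesh, the polynomial factor uses up half of the exponent; the remaining e^{-n
    mesh} is at most 1/(n mesh) <= a / M^3 <= a / M. *)
Lemma pow_exp_bound n c : (0 < n)%N -> a * c%:R <= m n ->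
  (n.+1 ^ c)%:R * expR (- (2 * (n%:R * mesh R n))) <= a / m n.
Proof.
move=> n0 hc; have m1 := gridsize_ge1 n; have h := mesh_bound n0.
have hmc : m n * c%:R <= n%:R * mesh R n.
  apply: le_trans h; rewrite ler_pdivlMr // mulrAC -mulrA.
  have -> : m n ^+ 3 = m n * (m n * m n) by ring.
  apply: ler_wpM2l; first lra.
  by nra.
apply: (@le_trans _ _ (expR (- (n%:R * mesh R n)))).
  apply: le_trans (ler_wpM2r (expR_ge0 _) (succ_pow_bound n c)) _.
  by rewrite -expRD ler_expR; lra.
have nm0 : 0 < n%:R * mesh R n.
  by rewrite mulr_gt0 ?mesh_gt0 // ltr0n.
rewrite expRN; apply: (@le_trans _ _ (n%:R * mesh R n)^-1).
  rewrite lef_pV2 ?posrE ?expR_gt0 //.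
  by apply: le_trans (expR_ge1Dx _); rewrite lerDr.
have am0 : 0 < a / m n by rewrite divr_gt0 ?gridsize_gt0.
rewrite -[X in _ <= X]invrK lef_pV2 ?posrE ?invr_gt0 //.
rewrite invfM invrK mulrC; apply: le_trans h.
apply: ler_wpM2r; first by rewrite invr_ge0 ltW.
by rewrite -[X in X <= _]expr1 ler_weXn2l.
Qed.

End Rates.

(** * Error and coding length of the universal code *)

Section UniversalCode.
Variables (R : realType) (d : nat) (a : R).
Hypothesis d0 : (0 < d)%N.
Hypothesis a0 : 0 < a.
Local Notation C := R[i].
Local Notation m n := ((gridsize n)%:R : R).

Hypothesis pow5_bound : forall n, (0 < n)%N -> m n ^+ 5 <= a * n%:R.

Definition universal_code (n : nat) : vlcode R (pow_dim d n) :=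
  grid_code (@grid_space_nested R d n) (@grid_space_rank_gt0 R d d0 n)
    (@grid_space_full R d n) (ltn0Sn _ : (0 < gridsize n)%N).

Lemma shannon_ge0 (X : finType) (l : X -> R) : (forall x, 0 <= l x) ->
  \sum_x l x = 1 -> 0 <= shannon l.
Proof.
move=> l0 l1; rewrite /shannon -sumrN; apply: sumr_ge0 => x _.
rewrite -mulrN mulr_ge0 // oppr_ge0 ln_le0 //.
by rewrite -l1 (bigD1 x) //= lerDl sumr_ge0.
Qed.

Section Fixed.
Variable p : source R d.
Local Notation rho := (average p).
Local Notation S := (shannon (spec rho)).
Local Notation V := (ln_variance (spec rho)).

Let hrho : density rho := average_density p.

(** Adding 2 to the rounded entropy puts this level at least one mesh width above it, as
    [grid_mass_upper] asks, and at most two. *)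
Definition top_level (n : nat) : nat := (Num.truncn (m n ^+ 2 * S)).+2.

Lemma S_ge0 : 0 <= S.
Proof. by apply: shannon_ge0; [exact: spec_ge0|exact: spec_sum]. Qed.

Lemma top_level_bounds n :
  m n ^+ 2 * S + 1 <= (top_level n)%:R <= m n ^+ 2 * S + 2.
Proof.
have h : 0 <= m n ^+ 2 * S by rewrite mulr_ge0 ?S_ge0 // exprn_ge0.
have /andP[h1 h2] := truncn_itv h.
rewrite /top_level -[X in _ <= X <= _]natr1 -[X in _ <= X + 1 <= _]natr1.
rewrite -natr1 in h2; apply/andP; split; lra.
Qed.

Lemma top_level_le n : (top_level n <= grid_levels d n * gridsize n)%N.
Proof.
rewrite -(ler_nat R) /grid_levels -mulnA mulnn natrM natrX natrD.
have /andP[_ h] := top_level_bounds n; apply: (le_trans h).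
have hS : S <= d%:R by have := shannon_le_card (spec_ge0 hrho); rewrite card_ord.
have m1 : 1 <= m n ^+ 2 by rewrite exprn_ege1 // gridsize_ge1.
by nra.
Qed.

Definition target (n : nat) (s : 'I_(gridsize n)) : 'I_(grid_levels d n).+1 :=
  inord (cell_of (gridsize n) (top_level n) s).

Lemma targetE n (s : 'I_(gridsize n)) :
  target s = cell_of (gridsize n) (top_level n) s :> nat.
Proof. by rewrite inordK // ltnS cell_of_le // top_level_le. Qed.

Definition miss (n : nat) : R :=
  weight (miss_op (grid_space R d n) (@target n)) (tens (fun _ : 'I_n => rho)).

Lemma miss_le n : (0 < n)%N -> a * (d + d * d)%:R <= m n ->
  miss n <= (2 * a * (V + 1) + 4) / m n.
Proof.
move=> n0 hc; have m0 := gridsize_gt0 R n.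
have [hp tr1] : density (tens (fun _ : 'I_n => rho)) by exact: tensor_density.
have V0 : 0 <= V by apply: ln_variance_ge0; exact: spec_ge0.
have me0 := mesh_gt0 R n.
(* Both tails fit under eta: a V / M comes from Chebyshev's inequality and a / M from the dimension
   count. *)
pose x j := grid_mass rho n j; pose eta := (a * (V + 1)) / m n.
have eta1 : V / (n%:R * mesh R n ^+ 2) <= a / m n * V.
  by rewrite mulrC; apply: ler_wpM2r => //; exact: (mesh_sqr_bound pow5_bound).
have eta2 := pow_exp_bound a0 pow5_bound n0 hc.
have am0 : 0 <= a / m n by rewrite divr_ge0 // ltW.
have etaE : eta = a / m n * V + a / m n by rewrite /eta; field; rewrite gt_eqF.
have /andP[t1 t2] := top_level_bounds n.
have meshE : mesh R n * m n ^+ 2 = 1 by rewrite /mesh mulVf // expf_neq0 // gt_eqF.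
have hup j : (top_level n <= j)%N -> 1 - eta <= x j.
  move=> hj; apply: le_trans (grid_mass_upper hrho n0 _); first lra.
  have hj' : (top_level n)%:R <= j%:R :> R by rewrite ler_nat.
  have := ler_wpM2r (ltW me0) (le_trans t1 hj'); rewrite mulrDl mul1r.
  by rewrite mulrAC (mulrC (m n ^+ 2)) meshE mul1r.
(* Being at least 5 levels below [top_level] means j <= M^2 S - 3, the margin of [grid_mass_lower].
   At most 4 shifts are then bad, the 4 of the final bound. *)
have hlo j : (j + 4 < top_level n)%N -> x j <= eta.
  move=> hj; apply: le_trans (grid_mass_lower hrho n0 _) _; last lra.
  have hj' : j%:R + 5 <= (top_level n)%:R :> R by rewrite -natrD ler_nat; lia.
  have h : j%:R + 3 <= m n ^+ 2 * S by lra.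
  have := ler_wpM2r (ltW me0) h; rewrite mulrDl.
  by rewrite [X in _ <= X]mulrAC (mulrC (m n ^+ 2)) meshE mul1r lerBrDr.
have x01 j : 0 <= x j <= 1.
  by apply: weight_proj_bounds => //; exact: orthoproj_proj.
have eta0 : 0 <= eta by rewrite etaE addr_ge0 // mulr_ge0.
have := shift_average (gridsize n) x01 eta0 hup hlo.
rewrite /miss weight_miss_op // => h.
have -> : (2 * a * (V + 1) + 4) / m n = (m n)^-1 * (m n * (2 * eta) + 4).
  by rewrite /eta; field; rewrite gt_eqF.
apply: ler_wpM2l; first by rewrite invr_ge0 ltW.
apply: le_trans h; apply: ler_sum => s _; rewrite lerD2l lerN2 targetE.
rewrite /weight grid_cell_trace /x /grid_mass /weight /cell.
by case: cell_of => [|k]; rewrite ?subr0 // -ReB.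
Qed.

(** The target cell ends less than M levels above [top_level], itself at most 2 levels above the
    entropy, which costs (M + 2) / M^2 <= 3 / M. The data set and the polynomial factor cost O(M^2)
    before division by n, absorbed through M^5 <= a n. *)
Lemma target_length n (s : 'I_(gridsize n)) : (0 < n)%N ->
  n%:R^-1 * (ln #|grid_data (gridsize n) (grid_levels d n)|%:R
    + ln (grid_dim (grid_space R d n) (s, target s))%:R)
  <= S + (a * (d + 3 + (d + d * d))%:R + 3) / m n.
Proof.
move=> n0; have m1 := gridsize_ge1 R n; have h5 := pow5_bound n0.
have nR : 0 < n%:R :> R by rewrite ltr0n.
set c := (d + d * d)%N; have me0 := mesh_gt0 R n.
(* The crude ln k <= k is affordable, as there are only M ((d + 2) M + 1) <= (d + 3) M^2
   outcomes. *)
have h1 : ln #|grid_data (gridsize n) (grid_levels d n)|%:R <= (d + 3)%:R * m n ^+ 2.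
  have ln_le (k : nat) : ln k%:R <= k%:R :> R.
    have [->|k0] := posnP k; first by rewrite ln0.
    rewrite -[X in _ <= X]expRK ler_ln ?posrE ?expR_gt0 ?ltr0n //.
    by apply: le_trans (expR_ge1Dx _); rewrite lerDr.
  apply: le_trans (ln_le _) _.
  rewrite card_prod !card_ord -natrX -natrM ler_nat /grid_levels.
  have : (0 < gridsize n)%N by []. nia.
have h2 : ln (grid_dim (grid_space R d n) (s, target s))%:R
    <= m n * c%:R + n%:R * ((top_level n)%:R + m n) * mesh R n.
  rewrite -[X in _ <= X]expRK ler_ln ?posrE ?expR_gt0 ?ltr0n ?grid_space_rank_gt0 //.
  apply: (@le_trans _ _ (n.+1 ^ c * threshold R n (s + target s * gridsize n))%:R).
    by rewrite ler_nat; exact: grid_space_rank.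
  rewrite natrM expRD; apply: ler_pM => //; first exact: succ_pow_bound.
  apply: le_trans (threshold_le _ _ _) _; rewrite ler_expR -mulrA.
  apply: ler_wpM2l => //; apply: ler_wpM2r; first exact: ltW.
  by rewrite -natrD ler_nat targetE ltnW // cell_of_lt_add.
have /andP[_ t2] := top_level_bounds n.
rewrite ler_pdivrMl //.
have meshE : mesh R n * m n ^+ 2 = 1 by rewrite /mesh mulVf // expf_neq0 // gt_eqF // gridsize_gt0.
have h3 : n%:R * ((top_level n)%:R + m n) * mesh R n
    <= n%:R * (S + 3 / m n).
  rewrite -mulrA; apply: ler_wpM2l => //.
  apply: (@le_trans _ _ ((m n ^+ 2 * S + 2 + m n) * mesh R n)).
    by apply: ler_wpM2r; [exact: ltW|rewrite lerD2r].
  have -> : (m n ^+ 2 * S + 2 + m n) * mesh R n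
      = S * (mesh R n * m n ^+ 2) + (2 + m n) * mesh R n by ring.
  rewrite meshE mulr1 lerD2l /mesh; move: m1; move: (m n) => x x1.
  have -> : (2 + x) * x ^- 2 = (2 + x) / x / x by field; lra.
  apply: ler_wpM2r; first by rewrite invr_ge0; lra.
  by rewrite ler_pdivrMr; lra.
have h4 : (d + 3)%:R * m n ^+ 2 + m n * c%:R <= n%:R * (a * (d + 3 + c)%:R / m n).
  have -> : n%:R * (a * (d + 3 + c)%:R / m n)
      = (a * n%:R / m n) * ((d + 3)%:R + c%:R) by rewrite natrD; ring.
  apply: (@le_trans _ _ (m n ^+ 4 * ((d + 3)%:R + c%:R))); last first.
    apply: ler_wpM2r; first by rewrite addr_ge0.
    by rewrite ler_pdivlMr ?gridsize_gt0 // -exprSr.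
  rewrite mulrDr [X in X + _]mulrC; apply: lerD; apply: ler_wpM2r => //.
    by rewrite ler_weXn2l.
  by rewrite -[X in X <= _]expr1 ler_weXn2l.
apply: le_trans (lerD h1 h2) _.
have -> : n%:R * (S + (a * (d + 3 + c)%:R + 3) / m n)
  = n%:R * (a * (d + 3 + c)%:R / m n) + n%:R * (S + 3 / m n) by ring.
lra.
Qed.

End Fixed.
End UniversalCode.

(** * Passing to the limit *)

Section Limits.
Variable R : realType.

Lemma gridsize_ge (x : R) : \forall n \near \oo, x <= (gridsize n)%:R.
Proof.
near=> n; apply: (@le_trans _ _ (Num.truncn x).+1%:R); first exact/ltW/truncnS_gt.
rewrite ler_nat /gridsize ltnS; apply: trunc_log_max => //.
by near: n; exact: nbhs_infty_ge.
Unshelve. all: by end_near. Qed.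

Lemma squeeze_gridsize (f : nat -> \bar R) (b : R) :
  (\forall n \near \oo, (0 <= f n <= (b / (gridsize n)%:R)%:E)%E) ->
  f n @[n --> \oo] --> 0%E.
Proof.
move=> h; apply: (squeeze_cvge h); first exact: cvg_cst.
apply: cvg_EFin; first by near=> n.
rewrite -[X in _ --> X](mulr0 b); apply: cvgMr.
exact: gridsize_cvg.
Unshelve. all: by end_near. Qed.

End Limits.

Section TrivialCode.
Local Open Scope sesquilinear_scope.
Variables (R : realType) (N : nat).

Let K (_ : unit) : 'M[R[i]]_N := 1%:M.

Let K_sum : \sum_i (K i)^t* *m K i = 1%:M.
Proof.
by rewrite (bigD1 tt) //= big1 ?addr0 ?adjmx1 ?mulmx1 //; case.
Qed.

Let povm_sum1 : \sum_(w : unit) K w = 1%:M.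
Proof. by rewrite (bigD1 tt) //= big1 ?addr0 //; case. Qed.

(** Serves d = 0, where every trace is 0 and no source exists, so that any sequence of codes is a
    witness. *)
Definition trivial_code : vlcode R N :=
  @VLCode R N unit K (fun=> @posmx1 _ N) povm_sum1 (fun=> N)
    (fun=> kraus_chan K) (fun=> kraus_tpcp K_sum)
    (fun=> kraus_chan K) (fun=> kraus_tpcp K_sum).

End TrivialCode.

Theorem mainTheorem2 (R : realType) (d : nat) :
  exists c : forall n : nat, vlcode R (pow_dim d n),
    universal c /\
    forall (p : source R d) (eps : R), 0 < eps ->
      event_prob p
        [set w : data (c n) |
           entropy (average p) + eps <= n%:R^-1 * coding_length w]%SET
        @[n --> \oo] --> 0%E.
Proof.
have [d0|d0] := posnP d.
  have no_source (p : source R d) : False.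
    have := average_trace1 p; subst d.
    by rewrite /mxtrace big_ord0 => /esym/eqP; rewrite oner_eq0.
  exists (fun n => trivial_code R (pow_dim d n)).
  by split=> [p|p eps _]; case: (no_source p).
have [a a0 ha] := gridsize_pow5 R.
exists (universal_code R d0); split=> [p|p eps eps0].
  pose V := ln_variance (spec (average p)).
  apply: (@squeeze_gridsize _ _ (2 * (2 * a * (V + 1) + 4))).
  near=> n; have n0 : (0 < n)%N by near: n; exact: nbhs_infty_gt.
  have hn : a * (d + d * d)%:R <= (gridsize n)%:R.
    by near: n; exact: gridsize_ge.
  have /andP[-> /le_trans ->//] := avg_error_bounds (@grid_space_nested R d n)
    (@grid_space_rank_gt0 R d d0 n) (@grid_space_full R d n)
    (ltn0Sn _ : (0 < gridsize n)%N) (@target R d p n) p.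
  by rewrite lee_fin -mulrA; apply: ler_wpM2l => //; exact: miss_le.
pose V := ln_variance (spec (average p)).
apply: (@squeeze_gridsize _ _ (2 * a * (V + 1) + 4)).
near=> n; have n0 : (0 < n)%N by near: n; exact: nbhs_infty_gt.
have hn : a * (d + d * d)%:R <= (gridsize n)%:R.
  by near: n; exact: gridsize_ge.
have hl : (a * (d + 3 + (d + d * d))%:R + 3) / (gridsize n)%:R < eps.
  rewrite ltr_pdivrMr ?ltr0n // [X in _ < X]mulrC -ltr_pdivrMr //.
  apply: (@lt_le_trans _ _ ((a * (d + 3 + (d + d * d))%:R + 3) / eps + 1)).
    by rewrite ltrDl.
  by near: n; exact: gridsize_ge.
(* By [target_length], an outcome with this coding length cannot lie in the target cell of its
   shift, so the event is covered by the missed mass. *)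
have hA (w : grid_data (gridsize n) (grid_levels d n)) :
    w \in [set w : data (universal_code R d0 n) |
      entropy (average p) + eps <= n%:R^-1 * coding_length w]%SET ->
    w.2 != target p w.1.
  rewrite inE (entropyE (average_density p)); apply: contraTN => /eqP e.
  have := target_length d0 a0 ha p w.1 n0; rewrite -e -surjective_pairing => h.
  rewrite -ltNge; apply: (le_lt_trans h).
  by rewrite ltrD2l.
have /andP[-> /le_trans ->//] := event_prob_bounds p hA.
by rewrite lee_fin; exact: miss_le.
Unshelve. all: by end_near. Qed.
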